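(* There exist transcendental entire functions $f$ and $g$ and infinitely many domains in $\mathbb{C}$, each of which lies in a periodic component of $F(f)$, in a periodic component of $F(g)$ and also in a periodic component of $F(g\circ f)$, but lies in a wandering component of $F(f\circ g)$.
   Context: A domain is a nonempty open connected subset of $\mathbb{C}$. For a transcendental entire function $h$, $h^n$ denotes its $n$-th iterate, and the Fatou set is $F(h)=\{z\in\mathbb{C}: \{h^n\}_{n\in\mathbb{N}} \text{ is normal in some neighborhood of } z\}$. A component of $F(h)$ means a connected component. For a component $U$ of $F(h)$ and $k\ge 0$, let $U_k$ denote the component of $F(h)$ containing $h^k(U)$ (so $U_0=U$). The component $U$ is called wandering if $U_k\cap U_l=\emptyset$ for all $k\neq l$; otherwise it is called preperiodic. It is called periodic if $U_k=U$ for some $k\ge 1$. A domain lies in a wandering (resp. periodic, preperiodic) component of $h$ if it is contained in some wandering (resp. periodic, preperiodic) component of $F(h)$. If $f,g$ are transcendental entire, so are $f\circ g$ and $g\circ f$, and these notions apply to them. *)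

(* Defs.v *)
From HB Require Import structures.
From mathcomp Require Import all_boot all_order all_algebra.
From mathcomp Require Import complex.
From mathcomp Require Import all_classical all_reals all_analysis.
Import Order.TTheory GRing.Theory Num.Theory.
Import numFieldNormedType.Exports.
Set Implicit Arguments.
Unset Strict Implicit.
Unset Printing Implicit Defensive.
Local Open Scope classical_set_scope.
Local Open Scope ring_scope.
Local Open Scope complex_scope.

(* Complex numbers as a numFieldType, so that they inherit the topology,
   uniformity and normed module structure (over themselves) of numeric fields:
   balls are taken for the complex modulus. *)
Definition Cplx (R : realType) : numFieldType := R[i].

Section Defs.
Variable R : realType.
Local Notation C := (Cplx R).
Implicit Types (f h : C -> C) (u : nat -> C -> C) (D K U V : set C).

Definition domain D := [/\ D !=set0, open D & connected D].

(* `derivable` over the scalar field C is complex differentiability. *)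
Definition entire f := forall z : C, derivable f z 1.

Definition transcendental_entire f :=
  entire f /\ ~ exists p : {poly C}, forall z, f z = p.[z].

(* Locally uniform convergence on V to a finite limit function. *)
Definition converges_on V u f :=
  forall K, compact K -> K `<=` V -> {uniform K, u @ \oo --> f}.

(* Locally uniform convergence on V to the constant oo of the Riemann sphere.
   On C, `<` between a real and a modulus is the order of the reals. *)
Definition diverges_on V u :=
  forall K, compact K -> K `<=` V ->
    forall M : R, \forall n \near \oo, forall z, K z -> (M%:C : C) < `|u n z|.

(* Normality in Montel's sense: the limit oo is allowed. *)
Definition normal_on V (F : set (C -> C)) :=
  forall u, (forall n, F (u n)) ->
    exists2 s : nat -> nat, {homo s : m n / (m < n)%N} &
      (exists f, converges_on V (u \o s) f) \/ diverges_on V (u \o s).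

Definition Fatou h : set C :=
  [set z | exists V, [/\ open V, V z & normal_on V (range (fun n => iter n h))]].

Definition Fatou_component h U :=
  exists2 z, Fatou h z & U = connected_component (Fatou h) z.

(* V is the component U_k of F(h) containing h^k(U). *)
Definition iterate_component h U k V :=
  Fatou_component h V /\ iter k h @` U `<=` V.

Definition wandering h U :=
  Fatou_component h U /\
  exists2 U_ : nat -> set C,
    forall k, iterate_component h U k (U_ k) &
    forall k l, k <> l -> U_ k `&` U_ l = set0.

Definition periodic h U :=
  Fatou_component h U /\ exists2 k, (0 < k)%N & iterate_component h U k U.

Definition lies_in_wandering h D := exists2 U, wandering h U & D `<=` U.

Definition lies_in_periodic h D := exists2 U, periodic h U & D `<=` U.

End Defs.

(* Main.v *)
Require Import Defs.
From mathcomp Require Import all_boot all_order all_algebra.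
From mathcomp Require Import complex ring lra.
From mathcomp Require Import all_classical all_reals all_analysis.
Import Order.TTheory GRing.Theory Num.Theory.
Import numFieldNormedType.Exports.
Set Implicit Arguments.
Unset Strict Implicit.
Unset Printing Implicit Defensive.
Local Open Scope classical_set_scope.
Local Open Scope ring_scope.

(** Put t = 2 pi i, a = pi i and b = pi i / 2. The functions f and g have the
    form z + P(exp z) with P a polynomial, so that both commute with the
    translation by t, and P is chosen by Hermite interpolation so that
      - f sends 0 to b, b to 0 and a to t;
      - g sends 0 to a, a to 0 and b to 0;
      - f'(0) = g'(0) = 0.
    Then f o f, g o g and g o f fix 0 with derivative 0, whereas f o g sends 0 to
    t with derivative 0. Hence a small disc around 0 is attracted to a cycle
    through 0 under f, g and g o f, while its image under the n-th iterate of
    f o g shrinks to the point n t. Every smaller disc around 0 does the same,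
    and there are infinitely many of these.

    What remains is to control whole components of the Fatou set. Call basin the
    set of points whose orbit, corrected by the translation by n t in the case
    of f o g, enters the small disc. The basin is open and lies in the Fatou set;
    the point is that it is also closed in the Fatou set, so that it contains
    every component that it meets (component_sub_clopen). Then the component of 0
    is invariant under two steps of f, g or g o f, and the components of f o g at
    the points j t lie in translates of one basin, which are pairwise disjoint.

    Closedness: let z be a Fatou point and a limit of the basin, and a a point of
    the basin so close to z that z lies well inside a disc around a on which the
    iterates are normal. Near a the corrected iterates decay geometrically. On
    the disc they grow at most polynomially: for an attracting cycle they are
    bounded, by normality. For h = f o g, normality makes h^n tend to infinity
    uniformly on the disc, so |h^n| > 1 there; Harnack's inequality for log |h^n|
    (harnack_power) bounds |h^n| by a fixed power of |h^n(a)|, which is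
    comparable to n. By Hadamard's three circles theorem geometric decay near a
    and polynomial growth on the disc force convergence to 0 at z
    (decay_half_disc).

    Both analytic facts rest on the second derivative test at a maximum, log |F|^2
    being harmonic off the zeros of F; no integration is involved. The Harnack
    inequality is the Ahlfors-Schwarz lemma for the pull-back under h^n of the
    hyperbolic metric of |w| > 1. *)

(** * The topology of the complex plane in terms of the modulus *)
Section ComplexPlane.
Variable R : realType.
Local Notation C := (Cplx R).

Definition modulus (z : C) : R := Normc.normc (z : R[i]).
Definition re (z : C) : R := complex.Re (z : R[i]).
Definition im (z : C) : R := complex.Im (z : R[i]).
Definition cplx (x y : R) : C := Complex x y.
Local Notation nm := modulus.

Lemma cplxE (z : C) : z = cplx (re z) (im z).
Proof. by case: z. Qed.

Lemma reD (z w : C) : re (z + w) = re z + re w. Proof. by case: z w => ? ? []. Qed.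
Lemma imD (z w : C) : im (z + w) = im z + im w. Proof. by case: z w => ? ? []. Qed.
Lemma reN (z : C) : re (- z) = - re z. Proof. by case: z. Qed.
Lemma imN (z : C) : im (- z) = - im z. Proof. by case: z. Qed.
Lemma reB (z w : C) : re (z - w) = re z - re w. Proof. by rewrite reD reN. Qed.
Lemma imB (z w : C) : im (z - w) = im z - im w. Proof. by rewrite imD imN. Qed.
Lemma reM (z w : C) : re (z * w) = re z * re w - im z * im w.
Proof. by case: z w => ? ? []. Qed.
Lemma imM (z w : C) : im (z * w) = re z * im w + im z * re w.
Proof. by case: z w => ? ? []. Qed.

Lemma complex_ext (z w : C) : re z = re w -> im z = im w -> z = w.
Proof. by rewrite [z]cplxE [w]cplxE => /= -> ->. Qed.

Lemma modulusE (z : C) : `|z| = (nm z)%:C%C :> R[i]. Proof. by []. Qed.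

Lemma modulus_ge0 (z : C) : 0 <= nm z.
Proof. by case: z => x y; exact: sqrtr_ge0. Qed.

Lemma sqr_modulus (z : C) : nm z ^+ 2 = re z ^+ 2 + im z ^+ 2.
Proof. by case: z => x y; rewrite /nm /= sqr_sqrtr// addr_ge0// sqr_ge0. Qed.

Lemma modulus0 : nm 0 = 0. Proof. exact: Normc.normc0. Qed.
Lemma modulus1 : nm 1 = 1. Proof. exact: Normc.normc1. Qed.
Lemma modulusM z w : nm (z * w) = nm z * nm w. Proof. exact: Normc.normcM. Qed.
Lemma modulusN z : nm (- z) = nm z. Proof. exact: normcN. Qed.
Lemma modulusD z w : nm (z + w) <= nm z + nm w. Proof. exact: le_normcD. Qed.
Lemma modulusB z w : nm (z - w) <= nm z + nm w.
Proof. by rewrite -(modulusN w) modulusD. Qed.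
Lemma modulusC z w : nm (z - w) = nm (w - z).
Proof. by rewrite -modulusN opprB. Qed.
Lemma modulusX z n : nm (z ^+ n) = nm z ^+ n.
Proof. by elim: n => [|n IH]; rewrite ?modulus1// !exprS modulusM IH. Qed.
Lemma modulus_eq0 z : (nm z == 0) = (z == 0).
Proof. by apply/eqP/eqP => [/Normc.eq0_normc|->]//; exact: modulus0. Qed.
Lemma modulus_gt0 z : (0 < nm z) = (z != 0).
Proof. by rewrite lt0r modulus_ge0 andbT modulus_eq0. Qed.
Lemma modulus_dist u v w : nm (u - w) <= nm (u - v) + nm (v - w).
Proof. by rewrite -[u - w](subrKA v) modulusD. Qed.
Lemma ler_modulusB z w : nm z - nm w <= nm (z - w).
Proof. by rewrite lerBlDr (le_trans _ (modulusD _ _))// subrK. Qed.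

Lemma re_le_modulus z : `|re z| <= nm z.
Proof.
rewrite -(@ler_pXn2r _ 2)// ?nnegrE ?normr_ge0 ?modulus_ge0//.
by rewrite sqr_modulus real_normK ?num_real// lerDl sqr_ge0.
Qed.

Lemma im_le_modulus z : `|im z| <= nm z.
Proof.
rewrite -(@ler_pXn2r _ 2)// ?nnegrE ?normr_ge0 ?modulus_ge0//.
by rewrite sqr_modulus real_normK ?num_real// lerDr sqr_ge0.
Qed.

Lemma modulus_le_re_im z : nm z <= `|re z| + `|im z|.
Proof.
rewrite -(@ler_pXn2r _ 2)// ?nnegrE ?addr_ge0 ?normr_ge0 ?modulus_ge0//.
rewrite sqr_modulus sqrrD !real_normK ?num_real//.
by rewrite addrAC lerDl mulrn_wge0// mulr_ge0.
Qed.

Lemma modulus_real (x : R) : nm (cplx x 0) = `|x|.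
Proof. by rewrite /nm /= expr0n addr0 sqrtr_sqr. Qed.

Lemma ltC_real (e : C) : 0 < e -> exists2 r : R, 0 < r & e = r%:C%C.
Proof.
case: e => x y; rewrite ltcE /= => /andP[/eqP -> x0]; by exists x.
Qed.

Lemma ltC_modulus (z : C) (d : R) : (`|z| < d%:C%C :> C) = (nm z < d).
Proof. exact: ltcR. Qed.

Lemma leC_modulusM (z w : C) (e : R) :
  (`|z| <= e%:C%C * `|w| :> C) = (nm z <= e * nm w).
Proof. by rewrite -lecR rmorphM. Qed.

(** The radii of balls are elements of the field itself; a positive complex
    number being real, real radii suffice. *)
Lemma nbhs_discP (z : C) (A : set C) :
  nbhs z A <-> exists2 r : R, 0 < r & forall w, nm (w - z) < r -> A w.
Proof.
rewrite nbhs_ballP; split.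
- move=> [e /= /ltC_real[r r0 ->]] zA; exists r => // w wr; apply: zA.
  by rewrite /ball /= modulusE ltcR modulusC.
- move=> [r r0 zA]; exists (r%:C%C); first by rewrite /= ltcR.
  by move=> w; rewrite /ball /= modulusE ltcR modulusC; exact: zA.
Qed.

Definition disc (a : C) (r : R) : set C := [set w | nm (w - a) < r].
Definition cdisc (a : C) (r : R) : set C := [set w | nm (w - a) <= r].

Lemma nbhs_disc a r : 0 < r -> nbhs a (disc a r).
Proof. by move=> r0; apply/nbhs_discP; exists r. Qed.

Lemma disc_center a r : 0 < r -> disc a r a.
Proof. by move=> r0; rewrite /disc /= subrr modulus0. Qed.

Lemma open_disc a r : open (disc a r).
Proof.
rewrite openE => w wr; rewrite /interior; apply/nbhs_discP.
exists (r - nm (w - a)); first by rewrite subr_gt0.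
move=> v; rewrite ltrBrDr => h; apply: le_lt_trans h; exact: modulus_dist.
Qed.

Lemma openP_disc (A : set C) : open A <->
  forall z, A z -> exists2 r, 0 < r & disc z r `<=` A.
Proof.
rewrite openE; split=> [Ao z /Ao /nbhs_discP//|h z /h Az].
by apply/nbhs_discP.
Qed.

Lemma continuous_discP (T : pseudoMetricType R) (f : C -> T) (z : C) :
  {for z, continuous f} <-> (forall e : R, 0 < e -> exists2 d, 0 < d &
    forall w, nm (w - z) < d -> ball (f z) e (f w)).
Proof.
split.
- move=> h e e0; have /h/nbhs_discP[d d0 ?] := nbhsx_ballx (f z) _ e0.
  by exists d.
- move=> h A /nbhs_ballP[e /= e0 eA]; have [d d0 dw] := h _ e0.
  by apply/nbhs_discP; exists d => // w /dw /eA.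
Qed.

Lemma continuousC_discP (f : C -> C) (z : C) :
  {for z, continuous f} <-> (forall e : R, 0 < e -> exists2 d, 0 < d &
    forall w, nm (w - z) < d -> nm (f w - f z) < e).
Proof.
split.
- move=> h e e0; have /h/nbhs_discP[d d0 ?] := nbhs_disc (f z) e0; by exists d.
- move=> h A /nbhs_discP[e e0 eA]; have [d d0 dw] := h _ e0.
  by apply/nbhs_discP; exists d => // w /dw /eA.
Qed.

Lemma continuous_modulus : continuous nm.
Proof.
move=> z; apply/continuous_discP => e e0; exists e => // w h.
rewrite /ball /= ltr_norml; apply/andP; split.
- rewrite ltrNl opprB; apply: le_lt_trans h; exact: ler_modulusB.
- by apply: le_lt_trans (ler_modulusB _ _) _; rewrite modulusC.
Qed.

Lemma continuous_cplx : continuous (fun p : R * R => cplx p.1 p.2).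
Proof.
move=> p A /nbhs_discP[e e0 eA].
apply/nbhs_ballP; exists (e / 2); first by rewrite /= divr_gt0.
move=> q [/= h1 h2]; apply: eA.
apply: le_lt_trans (modulus_le_re_im _) _.
by rewrite reB imB /= (splitr e) ltrD// distrC.
Qed.

Lemma closed_cdisc a r : closed (cdisc a r).
Proof.
rewrite -[X in closed X]setCK closedC openP_disc => w /= /negP.
rewrite -ltNge => hw; exists (nm (w - a) - r); first by rewrite subr_gt0.
move=> v; rewrite /disc /= => vw; apply/negP; rewrite -ltNge.
have := modulus_dist w v a; rewrite (modulusC w v); lra.
Qed.

Lemma compact_cdisc a r : compact (cdisc a r).
Proof.
have cS : compact ((fun p : R * R => cplx p.1 p.2) @`
    (`[re a - r, re a + r]%classic `*` `[im a - r, im a + r]%classic)).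
  apply: continuous_compact.
    by apply: continuous_subspaceT; exact: continuous_cplx.
  by apply: compact_setX; exact: segment_compact.
apply: subclosed_compact cS _; first exact: closed_cdisc.
move=> w /= h; exists (re w, im w); last by rewrite -cplxE.
have := le_trans (re_le_modulus _) h; have := le_trans (im_le_modulus _) h.
rewrite reB imB !ler_norml => /andP[? ?] /andP[? ?].
by split; rewrite /= in_itv /=; apply/andP; split; lra.
Qed.
End ComplexPlane.

(** * Complex differentiability and real derivatives along lines *)
Section Derivatives.
Variable R : realType.
Local Notation C := (Cplx R).
Local Notation nm := (@modulus R).

Lemma is_derive_epsP (K : numFieldType) (f : K -> K) (z df : K) :
  is_derive z 1 f df <-> (forall e : K, 0 < e -> exists2 d : K, 0 < d &
    forall h, `|h| < d -> `|f (h + z) - f z - h * df| <= e * `|h|).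
Proof.
split.
- move=> [dv vE] e e0.
  have cv : h^-1 *: (f (h *: 1 + z) - f z) @[h --> 0^'] --> df.
    by rewrite -vE; exact: dv.
  have /nbhs_ballP[d /= d0 dP] : \forall h \near nbhs (0 : K),
      h != 0 -> ball df e (h^-1 *: (f (h *: 1 + z) - f z)).
    by rewrite -near_withinE; exact: cv (nbhsx_ballx df _ e0).
  exists d => // h hd; have [->|h0] := eqVneq h 0.
    by rewrite add0r subrr mul0r subrr normr0 mulr0.
  have := dP h; rewrite /ball /= sub0r normrN => /(_ hd h0) /ltW.
  rewrite distrC => le; rewrite -ler_pdivrMr ?normr_gt0// -normfV -normrM.
  apply: le_trans le; rewrite /GRing.scale /= mulr1 mulrBl mulrAC divff//.
  by rewrite mul1r (mulrC _ h^-1).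
- move=> H.
  have cv : h^-1 *: (f (h *: 1 + z) - f z) @[h --> 0^'] --> df.
    move=> A /nbhs_ballP[e /= e0 eA].
    have [d d0 dP] := H _ (divr_gt0 e0 (ltr0Sn K 1)).
    suff : \forall h \near nbhs (0 : K),
        h != 0 -> A (h^-1 *: (f (h *: 1 + z) - f z)) by rewrite -near_withinE.
    apply/nbhs_ballP; exists d => // h.
    rewrite /ball /= sub0r normrN => hd h0; apply: eA; rewrite /ball /= distrC.
    have := dP h hd; rewrite -ler_pdivrMr ?normr_gt0// -normfV -normrM => le.
    rewrite /GRing.scale /= mulr1; apply: (@le_lt_trans _ _ (e / 2)).
      apply: le_trans le; rewrite [X in _ <= `|X|]mulrBl mulrAC divff// mul1r.
      by rewrite (mulrC _ h^-1).
    by rewrite ltr_pdivrMr// mulrDr mulr1 ltrDl.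
  by split; [apply/cvg_ex; exists df | apply/cvg_lim].
Qed.

Lemma is_derive_complexP (f : C -> C) (z df : C) :
  is_derive z 1 f df <-> (forall e : R, 0 < e -> exists2 d : R, 0 < d &
    forall h, nm h < d -> nm (f (z + h) - f z - h * df) <= e * nm h).
Proof.
rewrite is_derive_epsP; split=> H.
- move=> e e0; have [|_ /ltC_real[d d0 ->] dP] := H (e%:C%C).
    by rewrite ltcR.
  exists d => // h hd; have := dP h.
  by rewrite ltC_modulus (addrC z) leC_modulusM => /(_ hd).
- move=> _ /ltC_real[e e0 ->]; have [d d0 dP] := H _ e0.
  exists (d%:C%C); first by rewrite ltcR.
  move=> h; rewrite ltC_modulus (addrC h) leC_modulusM => hd; exact: (dP h hd).
Qed.

Lemma is_derive_chain (f g : C -> C) (z df dg : C) :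
  is_derive z 1 g dg -> is_derive (g z) 1 f df ->
  is_derive z 1 (f \o g) (df * dg).
Proof.
move=> /is_derive_complexP Hg /is_derive_complexP Hf.
apply/is_derive_complexP => e e0.
have pf : 0 < nm df + 1 by rewrite ltr_wpDl// modulus_ge0.
have pg : 0 < nm dg + 1 by rewrite ltr_wpDl// modulus_ge0.
have e20 : 0 < e / (2 * (nm dg + 1)) by rewrite divr_gt0// mulr_gt0.
have e10 : 0 < e / (2 * (nm df + 1)) by rewrite divr_gt0// mulr_gt0.
have [d2 d20 H2] := Hf _ e20.
have [d3 d30 H3] := Hg 1 ltr01.
have [d1 d10 H1] := Hg _ e10.
exists (Num.min d1 (Num.min d3 (d2 / (nm dg + 1)))).
  by rewrite !lt_min d10 d30 divr_gt0.
move=> h; rewrite !lt_min => /and3P[/H1{}H1 /H3{}H3 hd2].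
set k := g (z + h) - g z in H1 H3.
have kE : g (z + h) = g z + k by rewrite /k [RHS]addrC subrK.
have hk : nm k <= (nm dg + 1) * nm h.
  rewrite -[k](subrK (h * dg)) (le_trans (modulusD _ _))// modulusM.
  by rewrite mulrDl mul1r addrC (mulrC (nm h)) lerD2l -(mul1r (nm h)).
have {}H2 : nm (f (g z + k) - f (g z) - k * df) <= e / 2 * nm h.
  apply: le_trans (H2 _ _) _.
    by apply: le_lt_trans hk _; rewrite mulrC -ltr_pdivlMr.
  rewrite invfM (_ : _ * nm k = e / 2 * (nm k / (nm dg + 1))); last by ring.
  apply: ler_wpM2l; first by rewrite divr_ge0// ltW.
  by rewrite ler_pdivrMr// mulrC.
rewrite /= kE.
have -> : f (g z + k) - f (g z) - h * (df * dg) =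
    (f (g z + k) - f (g z) - k * df) + (k - h * dg) * df by ring.
apply: le_trans (modulusD _ _) _.
rewrite [leRHS](_ : _ = e / 2 * nm h + e / 2 * nm h); last first.
  by rewrite -mulrDl -splitr.
rewrite lerD//.
rewrite modulusM; apply: le_trans (ler_wpM2r (modulus_ge0 _) H1) _.
rewrite invfM.
rewrite (_ : _ * nm df = e / 2 * nm h * (nm df / (nm df + 1))); last by ring.
apply: ler_piMr; first by rewrite mulr_ge0 ?modulus_ge0// divr_ge0// ltW.
by rewrite ler_pdivrMr// mul1r lerDl.
Qed.

Definition line (z e : C) (t : R) : C := z + cplx t 0 * e.

Lemma is_derive_line (f : C -> C) (z e df : C) (t : R) :
  is_derive (line z e t) 1 f df ->
  is_derive t 1 (fun s => re (f (line z e s))) (re (e * df)) /\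
  is_derive t 1 (fun s => im (f (line z e s))) (im (e * df)).
Proof.
move=> /is_derive_complexP H.
have E h : line z e (h + t) = line z e t + cplx h 0 * e.
  rewrite /line -addrA; congr (_ + _); rewrite -mulrDl; congr (_ * _).
  by apply: complex_ext; rewrite ?reD ?imD /= ?addr0// addrC.
have key : forall eps : R, 0 < eps -> exists2 d : R, 0 < d & forall h : R,
    `|h| < d -> nm (f (line z e (h + t)) - f (line z e t) - cplx h 0 * (e * df))
      <= eps * `|h|.
  move=> eps eps0.
  have n0 : 0 < nm e + 1 by rewrite ltr_wpDl// modulus_ge0.
  have [d d0 dP] := H (eps / (nm e + 1)) (divr_gt0 eps0 n0).
  exists (d / (nm e + 1)); first by rewrite divr_gt0.
  move=> h; rewrite ltr_pdivlMr// => hd.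
  have hE : nm (cplx h 0 * e) = `|h| * nm e by rewrite modulusM modulus_real.
  rewrite E mulrA; apply: le_trans (dP _ _) _.
    by rewrite hE; apply: le_lt_trans hd; rewrite ler_wpM2l// lerDl.
  rewrite hE mulrCA mulrC ler_wpM2r// mulrAC ler_pdivrMr// ler_wpM2l ?ltW//.
  by rewrite ltrDl.
split; apply/is_derive_epsP => eps eps0; have [d d0 dP] := key _ eps0;
  exists d => // h /dP; apply: le_trans.
- apply: le_trans (re_le_modulus _).
  by rewrite !reB [re (cplx h 0 * _)]reM /= mul0r subr0.
- apply: le_trans (im_le_modulus _).
  by rewrite !imB [im (cplx h 0 * _)]imM /= mul0r addr0.
Qed.

Lemma is_derive_continuous (K : numFieldType) (f : K -> K) (z df : K) :
  is_derive z 1 f df -> {for z, continuous f}.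
Proof. by case=> /derivable1_diffP /differentiable_continuous. Qed.

(** A holomorphic function has derivatives of all orders, but here the functions
    are obtained from exp by ring operations and composition, and for these the
    tower of derivatives is built directly. *)
Fixpoint smooth (k : nat) (f : C -> C) : Prop :=
  if k is k'.+1 then
    exists2 f' : C -> C, (forall z : C, is_derive z 1 f (f' z)) & smooth k' f'
  else True.

Lemma smoothS k f : smooth k.+1 f -> smooth k f.
Proof.
elim: k f => [//|k IH] f [f' ff' /IH sf']; by exists f'.
Qed.

Lemma smooth_cst k (a : C) : smooth k (fun=> a).
Proof.
elim: k a => [//|k IH] a; exists (fun=> 0); last exact: IH.
by move=> z; exact: is_derive_cst.
Qed.

Lemma smooth_id k : smooth k (fun z => z).
Proof.
case: k => [//|k]; exists (fun=> 1); last exact: smooth_cst.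
by move=> z; exact: is_derive_id.
Qed.

Lemma smoothD k f g : smooth k f -> smooth k g -> smooth k (fun z => f z + g z).
Proof.
elim: k f g => [//|k IH] f g [f' ff' sf] [g' gg' sg].
exists (fun z => f' z + g' z); last exact: IH.
by move=> z; exact: is_deriveD.
Qed.

Lemma smoothM k f g : smooth k f -> smooth k g -> smooth k (fun z => f z * g z).
Proof.
elim: k f g => [//|k IH] f g sf sg; move: (sf) (sg).
move=> [f' ff' sf'] [g' gg' sg'].
exists (fun z => f z * g' z + g z * f' z); last first.
  by apply: smoothD; apply: IH => //; exact: smoothS.
by move=> z; exact: is_deriveM.
Qed.

Lemma smoothN k f : smooth k f -> smooth k (fun z => - f z).
Proof.
move=> sf; have := smoothM (smooth_cst k (-1)) sf.
by congr smooth; apply/funext => z; rewrite mulN1r.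
Qed.

Lemma smoothX k f n : smooth k f -> smooth k (fun z => f z ^+ n).
Proof.
move=> sf; elim: n => [|n IH]; first exact: smooth_cst.
have := smoothM sf IH; congr smooth; apply/funext => z; by rewrite exprS.
Qed.

Lemma smooth_comp k f g : smooth k f -> smooth k g -> smooth k (f \o g).
Proof.
elim: k f g => [//|k IH] f g sf sg; move: (sf) (sg).
move=> [f' ff' sf'] [g' gg' sg'].
exists (fun z => f' (g z) * g' z); first by move=> z; exact: is_derive_chain.
apply: smoothM => //; apply: IH => //; exact: smoothS.
Qed.

Lemma smooth_iter k f n : smooth k f -> smooth k (iter n f).
Proof.
move=> sf; elim: n => [|n IH]; first exact: smooth_id.
by have := smooth_comp sf IH; congr smooth; apply/funext.
Qed.

Lemma smooth_continuous k f : smooth k.+1 f -> continuous f.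
Proof. by move=> [f' ff' _] z; exact: is_derive_continuous (ff' z). Qed.

Lemma smooth_entire k f : smooth k.+1 f -> entire f.
Proof. by move=> [f' ff' _] z; have [] := ff' z. Qed.

End Derivatives.

(** * Laplacians and the second derivative test *)
Section Laplacian.
Variable R : realType.
Local Notation C := (Cplx R).
Local Notation nm := (@modulus R).

(** The derivative is only required near 0, so that logarithms of functions that
    may vanish elsewhere are covered. *)
Definition jet2 (u : R -> R) (d1 d2 : R) :=
  exists v : R -> R, [/\ \forall t \near (0 : R), is_derive (t : R) 1 u (v t),
    v 0 = d1 & is_derive (0 : R) 1 v d2].

Lemma jet2_eq u d1 d2 e1 e2 : jet2 u d1 d2 -> d1 = e1 -> d2 = e2 -> jet2 u e1 e2.
Proof. by move=> ? <- <-. Qed.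

Lemma jet2_cst (c : R) : jet2 (fun=> c) 0 0.
Proof.
exists (fun=> 0); split => //; last exact: is_derive_cst.
by near=> t; exact: is_derive_cst.
Unshelve. all: by end_near. Qed.

Lemma jet2D u d1 d2 v e1 e2 : jet2 u d1 d2 -> jet2 v e1 e2 ->
  jet2 (fun t => u t + v t) (d1 + e1) (d2 + e2).
Proof.
move=> [u' [uu' <- u'']] [v' [vv' <- v'']].
exists (fun t => u' t + v' t); split => //; last exact: is_deriveD.
near=> t; apply: is_deriveD; near: t; [exact: uu' | exact: vv'].
Unshelve. all: by end_near. Qed.

Lemma jet2Z u d1 d2 c : jet2 u d1 d2 -> jet2 (fun t => c * u t) (c * d1) (c * d2).
Proof.
move=> [u' [uu' <- u'']].
exists (fun t => c * u' t); split => //; last exact: is_deriveZ.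
by near=> t; apply: is_deriveZ; near: t; exact: uu'.
Unshelve. all: by end_near. Qed.

Lemma jet2_sqr u d1 d2 : jet2 u d1 d2 ->
  jet2 (fun t => u t ^+ 2) (2 * (u 0 * d1)) (2 * (d1 ^+ 2 + u 0 * d2)).
Proof.
move=> [u' [uu' <- u'']].
have -> : (fun t => u t ^+ 2) = u * u by apply/funext => t; rewrite expr2.
exists (fun t => 2 * (u t * u' t)); split => //.
- near=> t; have H : is_derive t 1 u (u' t) by near: t; exact: uu'.
  apply: (is_derive_eq (is_deriveM H H)).
  by rewrite /GRing.scale /=; ring.
- have u0 := nbhs_singleton uu'.
  apply: is_deriveZ; apply: (is_derive_eq (is_deriveM u0 u'')).
  by rewrite /GRing.scale /= addrC expr2.
Unshelve. all: by end_near. Qed.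

Lemma jet2_ln u d1 d2 : 0 < u 0 -> jet2 u d1 d2 ->
  jet2 (fun t => ln (u t)) (d1 / u 0) (d2 / u 0 - (d1 / u 0) ^+ 2).
Proof.
move=> u0 [u' [uu' <- u'']]; have uu0 := nbhs_singleton uu'.
have up : \forall t \near (0 : R), 0 < u t.
  have := is_derive_continuous uu0; move/(_ [set x | 0 < x]); apply.
  by apply: open_nbhs_nbhs; split; [exact: open_gt|].
exists (fun t => u' t / u t); split => //.
- near=> t; have H : is_derive t 1 u (u' t) by near: t; exact: uu'.
  have ut : 0 < u t by near: t.
  apply: (is_derive_eq (@is_derive1_comp _ (@ln R) u _ _ _
    (is_derive1_ln ut) H)).
  by rewrite mulrC.
- have un : u 0 != 0 by rewrite gt_eqF.
  apply: (is_derive_eq (is_deriveM u'' (is_deriveV un uu0))).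
  rewrite /GRing.scale /=; field; exact: un.
Unshelve. all: by end_near. Qed.

Lemma jet2_max u d1 d2 : jet2 u d1 d2 ->
  (\forall t \near (0 : R), u t <= u 0) -> d2 <= 0.
Proof.
move=> [v [uv v0 vv]] umax.
have [r r0 rP] : exists2 r : R, 0 < r & forall t : R, `|t| < r ->
    is_derive t 1 u (v t) /\ u t <= u 0.
  have /nbhs_ballP[r r0 rP] : \forall t \near (0 : R),
      is_derive (t : R) 1 u (v t) /\ u t <= u 0 by near=> t; split; near: t.
  by exists r => // t tr; apply: rP; rewrite /ball /= sub0r normrN.
have iP t : t \in `](- r), r[ -> `|t| < r by rewrite in_itv /= ltr_norml.
have u'0 : is_derive (0 : R) 1 u 0.
  apply: (@derive1_at_max _ u (- r) r 0).
  - by rewrite ge0_cp// ltW.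
  - by move=> t /iP /rP [[]].
  - by rewrite in_itv /= r0 oppr_lt0 r0.
  - by move=> t /iP /rP [].
have {v0 d1} v0 : v 0 = 0.
  have [|u1 _] := rP 0; first by rewrite normr0.
  by rewrite -(@derive_val _ _ _ _ _ _ _ u1) (@derive_val _ _ _ _ _ _ _ u'0).
rewrite leNgt; apply/negP => d20.
have [d d0 dP] := (is_derive_epsP _ _ _).1 vv _ (divr_gt0 d20 (ltr0Sn _ 1)).
pose h := Num.min r d / 2.
have md : 0 < Num.min r d by rewrite lt_min r0.
have h0 : 0 < h by rewrite divr_gt0.
have [hr hd] : h < r /\ h < d.
  by apply/andP; rewrite -lt_min /h ltr_pdivrMr// mulrDr mulr1 ltrDl.
have vpos t : 0 < t -> t <= h -> 0 < v t.
  move=> t0 th; have := dP t; rewrite gtr0_norm// => /(_ (le_lt_trans th hd)).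
  rewrite addr0 v0 subr0 ler_norml => /andP[+ _].
  have : 0 < d2 / 2 * t by rewrite mulr_gt0// divr_gt0.
  have -> : t * d2 = d2 / 2 * t + d2 / 2 * t by field.
  lra.
have [||c] := @MVT _ u v 0 h h0.
- move=> t; rewrite in_itv /= => /andP[t0 th].
  by have [] := rP t; rewrite ?gtr0_norm// (lt_trans th).
- apply: continuous_in_subspaceT => t; rewrite inE /= in_itv /= => /andP[t0 th].
  have [|tt _] := rP t; first by rewrite ger0_norm// (le_lt_trans th).
  exact: is_derive_continuous tt.
rewrite in_itv /= => /andP[c0 ch]; rewrite subr0 => E.
have := mulr_gt0 (vpos c c0 (ltW ch)) h0; rewrite -E subr_gt0 ltNge.
by have [|_ ->] := rP h; rewrite ?gtr0_norm.
Unshelve. all: by end_near. Qed.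

Definition ii : C := cplx 0 1.

(** The gradient is carried along with the Laplacian L because the Laplacian of
    a logarithm depends on it. *)
Definition lap (phi : C -> R) (z : C) (gx gy L : R) :=
  exists dx dy, [/\ jet2 (fun t => phi (line z 1 t)) gx dx,
    jet2 (fun t => phi (line z ii t)) gy dy & L = dx + dy].

Lemma line0 (z e : C) : line z e 0 = z.
Proof.
by apply: complex_ext; rewrite /line ?reD ?imD ?reM ?imM /=; ring.
Qed.

Lemma lap_cst (c : R) z : lap (fun=> c) z 0 0 0.
Proof. by exists 0, 0; split; rewrite ?addr0//; exact: jet2_cst. Qed.

Lemma lapD p z px py P q qx qy Q : lap p z px py P -> lap q z qx qy Q ->
  lap (fun w => p w + q w) z (px + qx) (py + qy) (P + Q).
Proof.
move=> [a [b [pa pb ->]]] [c [d [qc qd ->]]].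
by exists (a + c), (b + d); split; rewrite 1?addrACA//; exact: jet2D.
Qed.

Lemma lapZ p z px py P c : lap p z px py P ->
  lap (fun w => c * p w) z (c * px) (c * py) (c * P).
Proof.
move=> [a [b [pa pb ->]]].
by exists (c * a), (c * b); split; rewrite ?mulrDr//; exact: jet2Z.
Qed.

Lemma lap_ln p z px py P : 0 < p z -> lap p z px py P ->
  lap (fun w => ln (p w)) z (px / p z) (py / p z)
    (P / p z - (px ^+ 2 + py ^+ 2) / p z ^+ 2).
Proof.
move=> pz [a [b [pa pb ->]]].
have := jet2_ln _ pa; have := jet2_ln _ pb; rewrite !line0 => /(_ pz) hb /(_ pz) ha.
exists (a / p z - (px / p z) ^+ 2), (b / p z - (py / p z) ^+ 2).
by split => //; field; rewrite gt_eqF.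
Qed.

Lemma lap_eq p z px py P qx qy Q : lap p z px py P ->
  px = qx -> py = qy -> P = Q -> lap p z qx qy Q.
Proof. by move=> ? <- <- <-. Qed.

Lemma continuous_line (z e : C) : continuous (line z e).
Proof.
move=> t A /nbhs_discP[r r0 rA]; have n0 : 0 < nm e + 1.
  by rewrite ltr_wpDl// modulus_ge0.
apply/nbhs_ballP; exists (r / (nm e + 1)); first by rewrite /= divr_gt0.
move=> s; rewrite /ball /= distrC ltr_pdivlMr// => h; apply: rA.
have -> : line z e s - line z e t = cplx (s - t) 0 * e.
  by rewrite /line opprD addrACA subrr add0r -mulrBl; congr (_ * _); apply: complex_ext;
    rewrite ?reB ?imB //= subrr.
rewrite modulusM modulus_real.
by apply: le_lt_trans h; rewrite ler_wpM2l// lerDl.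
Qed.

Lemma near_line (z e : C) (A : set C) :
  nbhs z A -> \forall t \near (0 : R), A (line z e t).
Proof. by move=> zA; apply: (@continuous_line z e 0); rewrite line0. Qed.

Lemma lap_max p z px py P : lap p z px py P ->
  nbhs z [set w | p w <= p z] -> P <= 0.
Proof.
move=> [a [b [pa pb ->]]] zmax.
have := jet2_max pa; have := jet2_max pb; rewrite !line0 => hb ha.
have {}ha := ha (near_line 1 zmax).
have {}hb := hb (near_line ii zmax); lra.
Qed.

Lemma jet2_sqr_modulus (F F' F'' : C -> C) z e :
  (forall z : C, is_derive z 1 F (F' z)) ->
  (forall z : C, is_derive z 1 F' (F'' z)) ->
  let a := F z in let b := e * F' z in let c := e * (e * F'' z) in
  jet2 (fun t => nm (F (line z e t)) ^+ 2)
    (2 * (re a * re b + im a * im b))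
    (2 * (re b ^+ 2 + im b ^+ 2 + re a * re c + im a * im c)).
Proof.
move=> FF FF' a b c.
have eF' (w : C) : is_derive w 1 (fun v => e * F' v) (e * F'' w) by exact: is_deriveZ.
have jr : jet2 (fun t => re (F (line z e t))) (re b) (re c).
  exists (fun t => re (e * F' (line z e t))); split.
  - by near=> t; exact: (is_derive_line (FF _)).1.
  - by rewrite line0.
  - by have := (is_derive_line (eF' (line z e 0))).1; rewrite line0.
have ji : jet2 (fun t => im (F (line z e t))) (im b) (im c).
  exists (fun t => im (e * F' (line z e t))); split.
  - by near=> t; exact: (is_derive_line (FF _)).2.
  - by rewrite line0.
  - by have := (is_derive_line (eF' (line z e 0))).2; rewrite line0.
have := jet2D (jet2_sqr jr) (jet2_sqr ji); rewrite line0 -/a => H.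
rewrite (_ : (fun t => _) = (fun t => re (F (line z e t)) ^+ 2 +
   im (F (line z e t)) ^+ 2)); last by apply/funext => t; rewrite sqr_modulus.
by apply: (jet2_eq H); ring.
Unshelve. all: by end_near. Qed.

(** The contributions of F'' along the directions 1 and i cancel, because i * i is
    -1: this is where complex differentiability enters. *)
Lemma lap_sqr_modulus (F F' F'' : C -> C) z :
  (forall z : C, is_derive z 1 F (F' z)) ->
  (forall z : C, is_derive z 1 F' (F'' z)) ->
  lap (fun w => nm (F w) ^+ 2) z
    (2 * (re (F z) * re (F' z) + im (F z) * im (F' z)))
    (2 * (im (F z) * re (F' z) - re (F z) * im (F' z)))
    (4 * nm (F' z) ^+ 2).
Proof.
move=> FF FF'.
have h1 := jet2_sqr_modulus z 1 FF FF'; have hi := jet2_sqr_modulus z ii FF FF'.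
eexists _, _; split; [apply: (jet2_eq h1) => // | apply: (jet2_eq hi) => // |].
- by rewrite mul1r.
- by rewrite /ii !(reM, imM) /=; ring.
- by rewrite sqr_modulus /ii !mul1r !(reM, imM) /=; ring.
Qed.

(** Since log |F|^2 is locally the real part of 2 log F, it is harmonic off the
    zeros of F. *)
Lemma lap_ln_sqr_modulus (F F' F'' : C -> C) z :
  (forall z : C, is_derive z 1 F (F' z)) ->
  (forall z : C, is_derive z 1 F' (F'' z)) -> F z != 0 ->
  exists gx gy, lap (fun w => ln (nm (F w) ^+ 2)) z gx gy 0 /\
    gx ^+ 2 + gy ^+ 2 = 4 * nm (F' z) ^+ 2 / nm (F z) ^+ 2.
Proof.
move=> FF FF' Fz.
have F0 : 0 < nm (F z) ^+ 2 by rewrite exprn_gt0// modulus_gt0.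
have F0' : re (F z) ^+ 2 + im (F z) ^+ 2 != 0 by rewrite -sqr_modulus gt_eqF.
have H := lap_ln F0 (lap_sqr_modulus z FF FF').
eexists _, _; split; first apply: (lap_eq H) => //.
  by rewrite !sqr_modulus; field.
by rewrite !sqr_modulus; field.
Qed.

End Laplacian.

(** * Consequences of the maximum principle *)
Section MaximumPrinciple.
Variable R : realType.
Local Notation C := (Cplx R).
Local Notation nm := (@modulus R).

Lemma continuousM_at (T : topologicalType) (f g : T -> R) z :
  {for z, continuous f} -> {for z, continuous g} ->
  {for z, continuous (fun w => f w * g w)}.
Proof. by move=> cf cg; exact: cvgM cf cg. Qed.

Lemma continuousX_at (T : topologicalType) (f : T -> R) n z :
  {for z, continuous f} -> {for z, continuous (fun w => f w ^+ n)}.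
Proof. by move=> cf; exact: continuous_comp cf (@exprn_continuous R n (f z)). Qed.

Lemma continuousV_at (T : topologicalType) (f : T -> R) z : f z != 0 ->
  {for z, continuous f} -> {for z, continuous (fun w => (f w)^-1)}.
Proof. by move=> fz cf; exact: cvgV fz cf. Qed.

Lemma near_gt (T : topologicalType) (f : T -> R) x z :
  {for z, continuous f} -> x < f z -> nbhs z [set w | x < f w].
Proof.
move=> cf xz; suff : nbhs (f z) [set y | x < y] by move=> /cf.
by apply: open_nbhs_nbhs; split; first exact: open_gt.
Qed.

Lemma near_lt (T : topologicalType) (f : T -> R) x z :
  {for z, continuous f} -> f z < x -> nbhs z [set w | f w < x].
Proof.
move=> cf xz; suff : nbhs (f z) [set y | y < x] by move=> /cf.
by apply: open_nbhs_nbhs; split; first exact: open_lt.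
Qed.

Lemma lap_sqr_dist (a z : C) :
  lap (fun w => nm (w - a) ^+ 2) z (2 * re (z - a)) (2 * im (z - a)) 4.
Proof.
have d1 (w : C) : is_derive w 1 (fun v : C => v - a) 1.
  by apply: (is_derive_eq (is_deriveB (is_derive_id w 1) (is_derive_cst a w 1)));
    rewrite subr0.
have d2 (w : C) : is_derive w 1 (fun _ : C => (1 : C)) 0 by exact: is_derive_cst.
apply: (lap_eq (lap_sqr_modulus z d1 d2)).
- by rewrite /= mulr1 mulr0 addr0.
- by rewrite /= mulr1 mulr0 subr0.
- by rewrite modulus1 expr1n mulr1.
Qed.

Lemma continuous_dist (a : C) : continuous (fun w => nm (w - a)).
Proof.
move=> z; apply/continuous_discP => e e0; exists e => // w h.
rewrite /ball /= ltr_norml; apply/andP; split.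
- have := modulus_dist w z a; lra.
- have := modulus_dist z w a; rewrite (modulusC z w); lra.
Qed.

(** A form of Hadamard's three circles theorem: a bound by a power of the
    distance to the centre passes from two circles to the annulus between them.
    The factor e pays for the term making the comparison function strictly
    subharmonic. *)
Lemma three_circles (F : C -> C) (a : C) (r0 r B : R) (n : nat) :
  smooth 2 F -> 0 < r0 -> r0 <= r ->
  (forall w, nm (w - a) = r0 -> nm (F w) ^+ 2 <= B * (r0 ^+ 2) ^+ n) ->
  (forall w, nm (w - a) = r -> nm (F w) ^+ 2 <= B * (r ^+ 2) ^+ n) ->
  forall w, r0 <= nm (w - a) <= r ->
    nm (F w) ^+ 2 <= expR 1 * B * (nm (w - a) ^+ 2) ^+ n.
Proof.
move=> [F' FF' [F'' F'F'' _]] r00 r0r Hr0 Hr w /andP[w0 wr].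
have rpos : 0 < r by exact: lt_le_trans r0r.
have Fc : continuous F by move=> z; exact: is_derive_continuous (FF' z).
pose P z := nm (F z) ^+ 2 / (nm (z - a) ^+ 2) ^+ n * expR (r ^- 2 * nm (z - a) ^+ 2).
pose K := [set z | r0 <= nm (z - a)] `&` cdisc a r.
have dpos z : r0 <= nm (z - a) -> 0 < nm (z - a) by exact: lt_le_trans.
have Kc : compact K.
  apply: (@subclosed_compact _ _ (cdisc a r)); last by move=> z [].
  - apply: closedI; last exact: closed_cdisc.
    apply: (@closed_comp _ _ (fun z => nm (z - a)) [set x | r0 <= x]).
      by move=> z _; exact: continuous_dist.
    exact: closed_ge.
  - exact: compact_cdisc.
have Pc : {within K, continuous P}.
  apply: continuous_in_subspaceT => z; rewrite inE => -[/dpos z0 _].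
  have cd := @continuous_dist a z.
  have cF : {for z, continuous (fun z => nm (F z))}.
    by apply: continuous_comp; [exact: Fc | exact: continuous_modulus].
  suff : {for z, continuous P} by [].
  apply: continuousM_at; first apply: continuousM_at.
  - exact: continuousX_at.
  - apply: continuousV_at; first by rewrite expf_neq0// expf_neq0// gt_eqF.
    by apply: continuousX_at; exact: continuousX_at.
  - apply: continuous_comp; last exact: continuous_expR.
    by apply: continuousM_at; [exact: cst_continuous | exact: continuousX_at].
have [|c cK cmax] := compact_EVT_max _ Kc Pc; first by exists w; split.
move: cK; rewrite inE => -[/= c0 cr].
have Pw : P w <= P c by apply: cmax; rewrite inE; split.
have exp1 z : nm (z - a) <= r -> 1 <= expR (r ^- 2 * nm (z - a) ^+ 2) <= expR 1.
  move=> zr; apply/andP; split.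
    rewrite -[leLHS]expR0 ler_expR.
    by rewrite mulr_ge0 ?invr_ge0 ?exprn_ge0 ?modulus_ge0// ltW.
  rewrite ler_expR mulrC ler_pdivrMr ?exprn_gt0// mul1r.
  by rewrite lerXn2r ?nnegrE ?modulus_ge0// ltW.
have wn0 : 0 < (nm (w - a) ^+ 2) ^+ n by rewrite !exprn_gt0// dpos.
suff Pb : P c <= expR 1 * B.
  have {Pb}Pw := le_trans Pw Pb; rewrite -ler_pdivrMr//.
  apply: le_trans Pw; rewrite /P ler_peMr ?divr_ge0 ?exprn_ge0 ?modulus_ge0//.
  by have /andP[] := exp1 w wr.
have B0 : 0 <= B.
  have Fr : nm (F (a + cplx r 0)) ^+ 2 <= B * (r ^+ 2) ^+ n.
    by apply: Hr; rewrite [a + _]addrC addrK modulus_real gtr0_norm.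
  have := le_trans (exprn_ge0 _ (modulus_ge0 _)) Fr.
  by rewrite pmulr_lge0// !exprn_gt0.
have bnd q : 0 < q -> nm (c - a) = q ->
    (forall w, nm (w - a) = q -> nm (F w) ^+ 2 <= B * (q ^+ 2) ^+ n) ->
    P c <= expR 1 * B.
  move=> q0 cq Hq; rewrite /P cq mulrC; apply: ler_pM.
  - exact: expR_ge0.
  - by rewrite divr_ge0 ?exprn_ge0 ?modulus_ge0// ltW.
  - by rewrite -cq; have /andP[] := exp1 c cr.
  - by rewrite ler_pdivrMr ?exprn_gt0//; exact: Hq.
have [c1|c0'] := eqVneq (nm (c - a)) r0; first exact: bnd c1 Hr0.
have [c1|cr'] := eqVneq (nm (c - a)) r; first exact: bnd c1 Hr.
have [Fz|Fz] := eqVneq (F c) 0.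
  by rewrite /P Fz modulus0 expr0n mul0r mul0r mulr_ge0// expR_ge0.
(* at an interior maximum log P would have Laplacian 4 / r ^+ 2 > 0 *)
exfalso.
have ca : c - a != 0 by rewrite -modulus_gt0 dpos.
have [gx [gy [lF _]]] := lap_ln_sqr_modulus FF' F'F'' Fz.
have ca2 : nm (c - a) ^+ 2 = re (c - a) ^+ 2 + im (c - a) ^+ 2 by exact: sqr_modulus.
have ca2n : re (c - a) ^+ 2 + im (c - a) ^+ 2 != 0.
  by rewrite -ca2 expf_neq0// modulus_eq0.
have ld : lap (fun z => ln (nm (z - a) ^+ 2)) c (2 * re (c - a) / nm (c - a) ^+ 2)
   (2 * im (c - a) / nm (c - a) ^+ 2) 0.
  have dc : 0 < nm (c - a) ^+ 2 by rewrite exprn_gt0// dpos.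
  apply: (lap_eq (lap_ln dc (lap_sqr_dist a c))) => //.
  by rewrite ca2; move: (re _) (im _) ca2n => x y xy; field.
have := lapD (lapD lF (lapZ (- n%:R) ld)) (lapZ (r ^- 2) (lap_sqr_dist a c)).
move=> /lap_max; rewrite add0r mulr0 add0r leNgt mulr_gt0 ?invr_gt0 ?exprn_gt0//.
move=> H; suff /H : nbhs c [set z | ln (nm (F z) ^+ 2) +
    - n%:R * ln (nm (z - a) ^+ 2) + r ^- 2 * nm (z - a) ^+ 2 <=
    ln (nm (F c) ^+ 2) + - n%:R * ln (nm (c - a) ^+ 2) + r ^- 2 * nm (c - a) ^+ 2] by [].
have nF : nbhs c [set z | 0 < nm (F z)].
  have cF : {for c, continuous (fun z => nm (F z))}.
    by apply: continuous_comp; [exact: Fc | exact: continuous_modulus].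
  by apply: near_gt; rewrite // modulus_gt0.
have nK : nbhs c K.
  have cc := @continuous_dist a c.
  have h1 : nbhs c [set z | r0 < nm (z - a)].
    by apply: near_gt; rewrite // lt_neqAle eq_sym c0'.
  have h2 : nbhs c [set z | nm (z - a) < r].
    by apply: near_lt; rewrite // lt_neqAle cr'.
  by apply: filterS2 h1 h2 => z /= /ltW ? /ltW ?.
have lnP z : K z -> 0 < nm (F z) -> ln (P z) = ln (nm (F z) ^+ 2) +
    - n%:R * ln (nm (z - a) ^+ 2) + r ^- 2 * nm (z - a) ^+ 2.
  move=> [/dpos z0 _] Fz0.
  rewrite /P lnM ?posrE ?expR_gt0 ?divr_gt0 ?exprn_gt0// expRK.
  by rewrite ln_div ?posrE ?exprn_gt0// (lnXn n) ?exprn_gt0// mulNr mulr_natl.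
have Fc0 : 0 < nm (F c) by rewrite modulus_gt0.
have Kc' : K c by split.
apply: filterS2 nF nK => z /= Fz0 Kz; rewrite -!lnP// ler_ln ?posrE.
- by apply: cmax; rewrite inE.
- by case: Kz => /dpos ? _; rewrite /P mulr_gt0 ?expR_gt0 ?divr_gt0 ?exprn_gt0.
- by case: Kc' => /dpos ? _; rewrite /P mulr_gt0 ?expR_gt0 ?divr_gt0 ?exprn_gt0.
Qed.
End MaximumPrinciple.

(** * A Harnack inequality for functions of modulus greater than one *)
Section Harnack.
Variable R : realType.
Local Notation C := (Cplx R).
Local Notation nm := (@modulus R).

(** The metric |f'| |dz| / (|f| log |f|^2) has constant negative curvature off
    the zeros of f', like the hyperbolic metric of the disc, which is infinite on the boundary circle. At a
    maximum of their quotient the comparison of curvatures bounds the quotient. The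
    inequality is squared and cleared of denominators. *)
Lemma ahlfors_schwarz (f f' : C -> C) (a : C) (r : R) :
  (forall z : C, is_derive z 1 f (f' z)) -> smooth 2 f' -> 0 < r ->
  (forall w, cdisc a r w -> 1 < nm (f w)) ->
  forall w, cdisc a r w ->
    nm (f' w) ^+ 2 * (r ^+ 2 - nm (w - a) ^+ 2) ^+ 2 <=
    r ^+ 2 * (nm (f w) ^+ 2 * ln (nm (f w) ^+ 2) ^+ 2).
Proof.
move=> ff' sf' r0 fr w wr; move: (sf') => [f2 f'f2 [f3 f2f3 _]].
have fc : continuous f by move=> z; exact: is_derive_continuous (ff' z).
have f'c : continuous f' by exact: smooth_continuous sf'.
pose s z := r ^+ 2 + -1 * nm (z - a) ^+ 2.
have sE z : s z = r ^+ 2 - nm (z - a) ^+ 2 by rewrite /s mulN1r.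
pose v z := ln (nm (f z) ^+ 2).
have sqf1 z : cdisc a r z -> 1 < nm (f z) ^+ 2 by move=> /fr h; rewrite exprn_egt1.
have fgt0 z : cdisc a r z -> 0 < nm (f z) ^+ 2 by move=> /sqf1; exact: lt_trans.
have v0 z : cdisc a r z -> 0 < v z by move=> /sqf1 h; rewrite /v ln_gt0.
pose P z := nm (f' z) ^+ 2 * s z ^+ 2 / (nm (f z) ^+ 2 * v z ^+ 2).
have den0 z : cdisc a r z -> 0 < nm (f z) ^+ 2 * v z ^+ 2.
  by move=> zr; rewrite mulr_gt0 ?fgt0// exprn_gt0// v0.
suff {w wr} PP w : cdisc a r w -> P w <= r ^+ 2.
  by have := PP _ wr; rewrite /P ler_pdivrMr ?den0// sE.
move=> wr.
have cf z : {for z, continuous (fun w => nm (f w) ^+ 2)}.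
  by apply: continuousX_at; apply: continuous_comp; [exact: fc | exact: continuous_modulus].
have cf' z : {for z, continuous (fun w => nm (f' w) ^+ 2)}.
  by apply: continuousX_at; apply: continuous_comp; [exact: f'c | exact: continuous_modulus].
have cs z : {for z, continuous s}.
  have cd := continuousX_at (n := 2) (@continuous_dist _ a z).
  rewrite (funext sE); exact: cvgB (@cst_continuous _ _ (r ^+ 2) z) cd.
have Pc : {within cdisc a r, continuous P}.
  apply: continuous_in_subspaceT => z; rewrite inE => zr.
  suff : {for z, continuous P} by [].
  have cv : {for z, continuous v}.
    by apply: (continuous_comp (cf z)); apply: continuous_ln; exact: fgt0.
  apply: continuousM_at; first apply: continuousM_at => //.
    exact: continuousX_at.
  apply: continuousV_at; first by rewrite gt_eqF// den0.
  by apply: continuousM_at => //; exact: continuousX_at.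
have [|c cK cmax] := compact_EVT_max _ (@compact_cdisc _ a r) Pc; first by exists w.
move: cK; rewrite inE => cr.
apply: le_trans (cmax w _) _; first by rewrite inE.
have [//|Pgt] := lerP (P c) (r ^+ 2).
have r20 : 0 < r ^+ 2 by rewrite exprn_gt0.
have P0 : 0 < P c by exact: lt_trans Pgt.
have sc : 0 < s c.
  rewrite lt_neqAle; apply/andP; split.
    by apply/eqP => s0; move: P0; rewrite /P -s0 expr0n mulr0 mul0r ltxx.
  by rewrite sE subr_ge0 lerXn2r ?nnegrE ?modulus_ge0// ltW.
have f'n0 : f' c != 0.
  by apply/eqP => f'0; move: P0; rewrite /P f'0 modulus0 expr0n mul0r mul0r ltxx.
have f'c0 : 0 < nm (f' c) ^+ 2 by rewrite exprn_gt0// modulus_gt0.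
have fn0 : f c != 0 by rewrite -modulus_gt0 (lt_trans ltr01)// fr.
have [px [py [lf' _]]] := lap_ln_sqr_modulus f'f2 f2f3 f'n0.
have [qx [qy [lf qE]]] := lap_ln_sqr_modulus ff' f'f2 fn0.
have ls := lap_ln sc (lapD (lap_cst (r ^+ 2) c) (lapZ (-1) (lap_sqr_dist a c))).
have lv := lap_ln (v0 _ cr) lf.
have := lapD (lapD lf' (lapZ (-1) lf)) (lapD (lapZ 2 ls) (lapZ (-2) lv)).
move=> /lap_max H.
have Kc : nbhs c (cdisc a r).
  have h : nbhs c [set z | 0 < s z] by exact: near_gt.
  apply: filterS h => z /=; rewrite sE subr_gt0 => /ltW.
  by rewrite ler_sqr ?nnegrE ?modulus_ge0// ltW.

have Pnear : nbhs c [set z | [/\ cdisc a r z, 0 < s z & 0 < nm (f' z) ^+ 2]].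
  have h1 : nbhs c [set z | 0 < s z] by exact: near_gt.
  have h2 : nbhs c [set z | 0 < nm (f' z) ^+ 2] by exact: near_gt.
  by apply: filterS3 Kc h1 h2 => z ? ? ?; split.
have lnP z : cdisc a r z -> 0 < s z -> 0 < nm (f' z) ^+ 2 ->
    ln (nm (f' z) ^+ 2) + -1 * ln (nm (f z) ^+ 2) +
    (2 * ln (s z) + -2 * ln (ln (nm (f z) ^+ 2))) = ln (P z).
  move=> zr sz f'z; rewrite mulN1r -/(s z) -/(v z).
  have vz := v0 _ zr; have fz := fgt0 _ zr.
  have s2 : 0 < s z ^+ 2 by rewrite exprn_gt0.
  have v2 : 0 < v z ^+ 2 by rewrite exprn_gt0.
  have p2 : 0 < nm (f' z) ^+ 2 * s z ^+ 2 by exact: mulr_gt0.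
  have d2 := den0 z zr.
  rewrite /P ln_div ?posrE//.
  rewrite (@lnM _ (nm (f' z) ^+ 2)) ?(@lnM _ (nm (f z) ^+ 2)) ?posrE//.
  rewrite (lnXn 2 sz) (lnXn 2 vz) -/(v z).
  by move: (ln _) (ln _) (ln _) => ? ? ?; ring.
have {H Pnear} H : 0 + -1 * 0 +
    (2 * ((0 + -1 * 4) / s c - ((0 + -1 * (2 * re (c - a))) ^+ 2 +
      (0 + -1 * (2 * im (c - a))) ^+ 2) / s c ^+ 2) +
      -2 * (0 / v c - (qx ^+ 2 + qy ^+ 2) / v c ^+ 2)) <= 0.
  apply: H; apply: (filterS _ Pnear) => u [ur su f'u] /=.
  rewrite !lnP// ler_ln ?posrE//; first by apply: cmax; rewrite inE.
  by rewrite /P divr_gt0 ?den0// mulr_gt0// exprn_gt0.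
exfalso; move: H Pgt; rewrite qE /P -/(v c) ltr_pdivlMr ?den0//.
have sc2 : s c = r ^+ 2 - (re (c - a) ^+ 2 + im (c - a) ^+ 2).
  by rewrite sE sqr_modulus.
move: (sc) (fgt0 _ cr) (v0 _ cr); rewrite -/(v c).
move: (nm (f' c) ^+ 2) (nm (f c) ^+ 2) (v c) => A B V {}sc B0 V0 H.
rewrite ltNge => /negP; apply.
have E : 0 + -1 * 0 + (2 * ((0 + -1 * 4) / s c - ((0 + -1 * (2 * re (c - a))) ^+ 2 +
      (0 + -1 * (2 * im (c - a))) ^+ 2) / s c ^+ 2) +
      -2 * (0 / V - (4 * A / B) / V ^+ 2)) =
    8 / (s c ^+ 2 * (B * V ^+ 2)) * (A * s c ^+ 2 - r ^+ 2 * (B * V ^+ 2)).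
  move: sc sc2; move: (s c) (re (c - a)) (im (c - a)) => S x y S0 SE.
  have -> : r ^+ 2 = S + (x ^+ 2 + y ^+ 2) by rewrite SE subrK.
  by field; rewrite !gt_eqF.
move: H; rewrite E pmulr_rle0 ?subr_le0//.
by rewrite divr_gt0// mulr_gt0 ?exprn_gt0// mulr_gt0// exprn_gt0.
Qed.

Lemma is_derive_sqr_modulus_line (f f' : C -> C) (z e : C) (t : R) :
  (forall z : C, is_derive z 1 f (f' z)) ->
  is_derive t 1 (fun t => nm (f (line z e t)) ^+ 2)
    (2 * (re (f (line z e t)) * re (e * f' (line z e t)) +
          im (f (line z e t)) * im (e * f' (line z e t)))).
Proof.
move=> ff'; have [hr hi] := is_derive_line (ff' (line z e t)).
rewrite (_ : (fun t => _) = (fun t => re (f (line z e t)) * re (f (line z e t)) +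
   im (f (line z e t)) * im (f (line z e t)))); last first.
  by apply/funext => s; rewrite sqr_modulus !expr2.
apply: (is_derive_eq (is_deriveD (is_deriveM hr hr) (is_deriveM hi hi))).
by rewrite /GRing.scale /=; ring.
Qed.

Lemma re_mul_le_modulus (z w : C) : `|re z * re w + im z * im w| <= nm z * nm w.
Proof.
rewrite -(@ler_pXn2r _ 2)// ?nnegrE ?normr_ge0 ?mulr_ge0 ?modulus_ge0//.
rewrite real_normK ?num_real// exprMn !sqr_modulus.
by rewrite -subr_ge0 (_ : _ - _ = (re z * im w - im z * re w) ^+ 2) ?sqr_ge0//; ring.
Qed.

(** Ahlfors' form of the Schwarz lemma says that log log |f|^2 is a Lipschitz
    function, which bounds |f| near the centre by a power of its central value,
    with an exponent q that depends neither on f nor on the disc. *)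
Lemma harnack_power (f : C -> C) (a : C) (r : R) (q : nat) :
  smooth 3 f -> 0 < r -> expR 2 <= q%:R :> R ->
  (forall w, cdisc a r w -> 1 < nm (f w)) ->
  forall w, cdisc a (r / 2) w -> nm (f w) <= nm (f a) ^+ q.
Proof.
move=> [f' ff' sf'] r0 hq fr w wr.
have AS := ahlfors_schwarz ff' sf' r0 fr.
set e := w - a.
have er : nm e <= r / 2 by exact: wr.
have lr t : 0 <= t -> t <= 1 -> nm (line a e t - a) <= r / 2.
  move=> t0 t1; rewrite /line addrAC subrr add0r modulusM modulus_real ger0_norm//.
  by apply: le_trans er; rewrite ler_piMl ?modulus_ge0.
have lr' t : 0 <= t -> t <= 1 -> cdisc a r (line a e t).
  move=> t0 t1; apply: (le_trans (lr t t0 t1)); rewrite ler_pdivrMr//; lra.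
pose u t := nm (f (line a e t)) ^+ 2.
have u1 t : 0 <= t -> t <= 1 -> 1 < u t.
  by move=> t0 t1; rewrite exprn_egt1//; apply: fr; exact: lr'.
pose u' t := 2 * (re (f (line a e t)) * re (e * f' (line a e t)) +
          im (f (line a e t)) * im (e * f' (line a e t))).
have uu' (t : R) : is_derive t 1 u (u' t) by exact: is_derive_sqr_modulus_line.
pose y t := ln (ln (u t)).
have yy' (t : R) : 0 <= t -> t <= 1 -> is_derive t 1 y ((ln (u t))^-1 * ((u t)^-1 * u' t)).
  move=> t0 t1; have ut := u1 t t0 t1.
  apply: (@is_derive1_comp _ (@ln R) (fun t => ln (u t))).
    by apply: is_derive1_ln; rewrite ln_gt0.
  by apply: (@is_derive1_comp _ (@ln R) u); apply: is_derive1_ln; rewrite (lt_trans ltr01).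
have y'2 t : 0 <= t -> t <= 1 -> (ln (u t))^-1 * ((u t)^-1 * u' t) <= 2.
  move=> t0 t1; have ut := u1 t t0 t1; have u0 : 0 < u t by exact: lt_trans ut.
  have v0 : 0 < ln (u t) by rewrite ln_gt0.
  have vu0 : 0 < ln (u t) * u t by exact: mulr_gt0.
  rewrite mulrA -invfM mulrC ler_pdivrMr//.
  have sE := AS _ (lr' t t0 t1); have dr := lr t t0 t1.
  have := re_mul_le_modulus (f (line a e t)) (e * f' (line a e t)).
  rewrite modulusM => /(le_trans (ler_norm _)) uX.
  have N0 := modulus_ge0 (f (line a e t)).
  have D0 := modulus_ge0 (f' (line a e t)).
  have d0 := modulus_ge0 (line a e t - a).
  move: sE uX N0 D0 dr d0 v0; rewrite /u' /u.
  move: (nm (f' _)) (nm (f _)) (nm (_ - a)) => D N d.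
  move: (ln _) (re _ * _ + _) => V X sE uX N0 D0 dr d0 V0.
  have s0 : 3 / 4 * r ^+ 2 <= r ^+ 2 - d ^+ 2.
    have : d ^+ 2 <= (r / 2) ^+ 2 by rewrite lerXn2r// nnegrE; lra.
    by rewrite expr_div_n; lra.
  have r20 : 0 < r ^+ 2 by rewrite exprn_gt0.
  have Ds : D * (r ^+ 2 - d ^+ 2) <= r * (N * V).
    have p1 : 0 <= D * (r ^+ 2 - d ^+ 2) by apply: mulr_ge0 => //; lra.
    have p2 : 0 <= r * (N * V) by rewrite !mulr_ge0// ltW.
    by rewrite -(@ler_pXn2r _ 2)// !exprMn.
  have {}Ds : D * (3 / 4 * r) <= N * V.
    rewrite -(ler_pM2l r0); apply: le_trans Ds.
    have -> : r * (D * (3 / 4 * r)) = D * (3 / 4 * r ^+ 2) by ring.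
    by apply: ler_wpM2l.
  have ED : nm e * D <= N * V.
    have : nm e * D <= r / 2 * D by apply: ler_wpM2r.
    have : 0 <= r * D by rewrite mulr_ge0// ltW.
    move: Ds; lra.
  have : N * (nm e * D) <= N * (N * V) by apply: ler_wpM2l.
  rewrite expr2; move: uX; lra.
have [||c] := @MVT _ y (fun t => (ln (u t))^-1 * ((u t)^-1 * u' t)) 0 1 ltr01.
- move=> t; rewrite in_itv /= => /andP[/ltW t0 /ltW t1]; exact: yy'.
- apply: continuous_in_subspaceT => t; rewrite inE /= in_itv /= => /andP[t0 t1].
  exact: is_derive_continuous (yy' t t0 t1).
rewrite in_itv /= subr0 mulr1 => /andP[/ltW c0 /ltW c1] yE.
have := y'2 c c0 c1; rewrite -yE /y lerBlDr.
have u00 := u1 0 (lexx _) ler01; have u11 := u1 1 ler01 (lexx _).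
have fa : u 0 = nm (f a) ^+ 2 by rewrite /u line0.
have fw : u 1 = nm (f w) ^+ 2.
  rewrite /u (_ : line a e 1 = w)// /line (_ : cplx 1 0 = 1)//.
  by rewrite mul1r /e addrC subrK.
have l0 : 0 < ln (u 0) by rewrite ln_gt0.
have l1 : 0 < ln (u 1) by rewrite ln_gt0.
have u0 : 0 < u 0 by exact: lt_trans u00.
have u2 : 0 < u 1 by exact: lt_trans u11.
have uq : 0 < u 0 ^+ q by rewrite exprn_gt0.
have el : 0 < expR 2 * ln (u 0) by rewrite mulr_gt0// expR_gt0.
rewrite -[2]expRK -lnM ?posrE ?expR_gt0// ler_ln ?posrE// => h1.
have h2 : expR 2 * ln (u 0) <= ln (u 0 ^+ q).
  rewrite lnXn// -[leRHS]mulr_natl.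
  by apply: ler_wpM2r => //; rewrite ltW.
have := le_trans h1 h2; rewrite ler_ln ?posrE// fa fw -!exprM mulnC exprM.
by rewrite ler_pXn2r// nnegrE ?exprn_ge0//; exact: modulus_ge0.
Qed.
End Harnack.

(** * Normality of sequences of iterates *)
Section Normality.
Variable R : realType.
Local Notation C := (Cplx R).
Local Notation nm := (@modulus R).
Implicit Types (h f : C -> C) (u : nat -> C -> C) (K V : set C).

Lemma uniformC_P K u f : {uniform K, u @ \oo --> f} <->
  (forall e : R, 0 < e -> exists N, forall n, (N <= n)%N ->
    forall w, K w -> nm (u n w - f w) < e).
Proof.
split.
- move=> H e e0.
  have : nbhs (f : {uniform` K -> C}) [set g | forall w, K w -> nm (g w - f w) < e].
    apply/uniform_nbhs; exists [set xy : C * C | nm (xy.2 - xy.1) < e]; split=> //.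
    rewrite -entourage_ballE; exists (e%:C%C) => /=; first by rewrite ltcR.
    move=> [x y] /=; rewrite /ball /= modulusE ltcR modulusC; exact.
  move=> /H [N _ NP]; by exists N => n Nn; apply: NP.
- move=> H A /uniform_nbhs[E []]; rewrite -entourage_ballE.
  move=> [_ /= /ltC_real[e e0 ->] eE] EA.
  have [N NP] := H e e0; exists N => // n /= Nn; apply: EA => w Kw; apply: eE.
  by rewrite /= /ball /= modulusE ltcR modulusC NP.
Qed.

Lemma subsequence (P : nat -> nat -> Prop) :
  (forall n N, exists2 k, (N <= k)%N & P n k) ->
  exists2 s : nat -> nat, {homo s : m n / (m < n)%N} & forall n, P n (s n).
Proof.
move=> H; have /choice[F FP] : forall nN : nat * nat, exists k,
    (nN.2 <= k)%N /\ P nN.1 k by move=> [n N]; have [k ? ?] := H n N; exists k.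
pose s := fix s n := if n is n'.+1 then F (n, (s n').+1) else F (0, 0)%N.
exists s; last first.
  by case=> [|n]; [have [] := FP (0, 0)%N | have [] := FP (n.+1, (s n).+1)].
apply: (@homo_ltn _ s (fun i j => (i < j)%N)) => [j i k|n]; first exact: ltn_trans.
by have [] := FP (n.+1, (s n).+1).
Qed.

Lemma frequently_bounded_cst (m : nat -> nat) (B : nat) :
  (forall N, exists2 k, (N <= k)%N & (m k <= B)%N) ->
  exists c, forall N, exists2 k, (N <= k)%N & m k = c.
Proof.
elim: B => [|B IH] H.
  by exists 0%N => N; have [k ?] := H N; rewrite leqn0 => /eqP ?; exists k.
have [|noB] := pselect (exists c, forall N, exists2 k, (N <= k)%N & m k = c).
  by [].
apply: IH => N; apply: contrapT => nk; apply: noB; exists B.+1 => M.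
have [k] := H (maxn M N); rewrite geq_max => /andP[Mk Nk].
rewrite leq_eqVlt => /orP[/eqP mk|mk]; first by exists k.
by exfalso; apply: nk; exists k.
Qed.

(** Normality concerns arbitrary sequences of iterates, with exponents in any
    order and possibly repeated. This reduces them to two manageable cases; the
    parity matters for cycles of length 2. *)
Lemma exponents_subsequence (m : nat -> nat) :
  exists2 s : nat -> nat, {homo s : i j / (i < j)%N} &
    (exists c, forall n, m (s n) = c) \/
    (exists b : bool, forall n, exists2 k, (n <= k)%N & m (s n) = (b + k.*2)%N).
Proof.
have [[B BP]|H] := pselect (exists B, forall N, exists2 k, (N <= k)%N & (m k <= B)%N).
  have [c cP] := frequently_bounded_cst BP.
  have [s si sP] := @subsequence (fun _ k => m k = c) (fun _ => cP).
  by exists s => //; left; exists c.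
have {}H B : exists N, forall k, (N <= k)%N -> (B < m k)%N.
  apply: contrapT => nB; apply: H; exists B => N; apply: contrapT => nk.
  apply: nB; exists N => k Nk; rewrite ltnNge; apply/negP => mk.
  by apply: nk; exists k.
have [b bP] : exists b : bool, forall N, exists2 k, (N <= k)%N & odd (m k) = b.
  have [h1|h1] := pselect (forall N, exists2 k, (N <= k)%N & odd (m k) = true).
    by exists true.
  exists false => N; apply: contrapT => nk; apply: h1 => M.
  exists (maxn M N); first exact: leq_maxl.
  by apply/negPn/negP => /negbTE o; apply: nk; exists (maxn M N); rewrite ?leq_maxr.
have [|s si sP] := @subsequence (fun n k => (n.*2.+1 < m k)%N /\ odd (m k) = b).
  move=> n N; have [N1 N1P] := H n.*2.+1; have [k] := bP (maxn N N1).
  by rewrite geq_max => /andP[Nk N1k] ?; exists k => //; split=> //; exact: N1P.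
exists s => //; right; exists b => n; have [n2 nb] := sP n.
exists (m (s n))./2; last by rewrite -nb odd_double_half.
rewrite -[leqLHS]doubleK; apply: half_leq.
exact: leq_trans (leqnSn _) (ltnW n2).
Qed.

Lemma normal_constant V (u : nat -> C -> C) f :
  (forall n, u n = f) -> converges_on V u f.
Proof.
move=> uf K _ _; apply/uniformC_P => e e0; exists 0%N => n _ w _.
by rewrite uf subrr modulus0.
Qed.

Lemma normal_attracted_2cycle h V (phi : bool -> C) :
  (forall (b : bool) (e : R), 0 < e -> exists N, forall n, (N <= n)%N ->
    forall w, V w -> nm (iter (b + n.*2) h w - phi b) < e) ->
  normal_on V (range (fun n => iter n h)).
Proof.
move=> H u uP; have /choice[m mP] : forall n, exists k, iter k h = u n.
  by move=> n; have [k _ <-] := uP n; exists k.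
have [s si [[c cP]|[b bP]]] := exponents_subsequence m; exists s => //; left.
  by exists (iter c h); apply: normal_constant => n; rewrite /= -mP cP.
exists (fun=> phi b) => K _ KV; apply/uniformC_P => e e0.
have [N NP] := H b e e0; exists N => n Nn w /KV Vw.
have [k nk mk] := bP n.
by rewrite /= -mP mk; apply: NP => //; exact: leq_trans nk.
Qed.

Lemma normal_escaping h V :
  (forall M : R, exists N, forall n, (N <= n)%N ->
    forall w, V w -> M < nm (iter n h w)) ->
  normal_on V (range (fun n => iter n h)).
Proof.
move=> H u uP; have /choice[m mP] : forall n, exists k, iter k h = u n.
  by move=> n; have [k _ <-] := uP n; exists k.
have [s si [[c cP]|[b bP]]] := exponents_subsequence m; exists s => //.
  by left; exists (iter c h); apply: normal_constant => n; rewrite /= -mP cP.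
right => K _ KV M; have [N NP] := H M; exists N => // n /= Nn w /KV Vw.
have [k nk mk] := bP n.
rewrite modulusE ltcR /= -mP mk; apply: NP => //.
by apply: leq_trans Nn _; apply: leq_trans nk _; rewrite -addnn addnA leq_addl.
Qed.

Lemma continuous_bounded_compact (f : C -> C) K :
  continuous f -> compact K -> exists L, forall w, K w -> nm (f w) <= L.
Proof.
move=> cf cK; have [[w0 Kw0]|K0] := pselect (K !=set0); last first.
  by exists 0 => w Kw; exfalso; apply: K0; exists w.
have cnf : continuous (fun w => nm (f w)).
  by move=> w; apply: continuous_comp; [exact: cf | exact: continuous_modulus].
have [|c _ cmax] := compact_EVT_max _ cK (continuous_subspaceT cnf).
  by exists w0.
by exists (nm (f c)) => w Kw; apply: cmax; rewrite inE.
Qed.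

Lemma continuous_iter h n : continuous h -> continuous (iter n h).
Proof.
move=> ch; elim: n => [|n IH] z; first exact: cvg_id.
by apply: (continuous_comp (IH z)); exact: ch.
Qed.

(** A bounded orbit excludes the limit infinity for every subsequence, so an
    unbounded family of iterates would have a convergent subsequence, which is
    bounded on compact sets. *)
Lemma normal_bounded h V K a (M : R) : continuous h ->
  normal_on V (range (fun n => iter n h)) -> compact K -> K `<=` V -> K a ->
  (forall n, nm (iter n h a) <= M) ->
  exists L, forall n w, K w -> nm (iter n h w) <= L.
Proof.
move=> ch nV cK KV Ka aM; apply: contrapT => unb.
have /choice[m mP] : forall k : nat, exists n, exists2 w, K w & k%:R < nm (iter n h w).
  move=> k; apply: contrapT => nk; apply: unb; exists k%:R => n w Kw.
  by rewrite leNgt; apply/negP => ?; apply: nk; exists n, w.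
have [|s si [[f cvf]|dv]] := nV (fun k => iter (m k) h).
- by move=> n; exists (m n).
- have /uniformC_P/(_ 1 ltr01)[N NP] := cvf K cK KV.
  have [L LP] := continuous_bounded_compact (@continuous_iter h (m (s N)) ch) cK.
  pose n := maxn N (Num.truncn (`|L| + 2)).+1.
  have [w Kw] := mP (s n); apply/negP; rewrite -leNgt.
  have h1 := NP n (leq_maxl _ _) w Kw; have h2 := NP N (leqnn N) w Kw.
  have : nm (iter (m (s n)) h w) <= L + 2.
    have := modulus_dist (iter (m (s n)) h w) (f w) (iter (m (s N)) h w).
    have := ler_modulusB (iter (m (s n)) h w) (iter (m (s N)) h w).
    move: h1 h2; rewrite /= (modulusC _ (f w)) => h1; rewrite (modulusC _ (f w)).
    have := LP w Kw; rewrite (modulusC (f w)) => ? ? ?; lra.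
  move=> /le_trans; apply.
  have sn : (n <= s n)%N.
    elim: (n) => [//|k IH]; exact: leq_ltn_trans IH (si _ _ (ltnSn k)).
  apply: (@le_trans _ _ n%:R); last by rewrite ler_nat.
  apply: (@le_trans _ _ (Num.truncn (`|L| + 2)).+1%:R); last first.
    by rewrite ler_nat leq_maxr.
  apply: (@le_trans _ _ (`|L| + 2)); first by rewrite lerD2r ler_norm.
  by rewrite ltW// truncnS_gt.
- have [N _ NP] := dv K cK KV M; have := NP N (leqnn N) a Ka.
  by rewrite modulusE ltcR /= ltNge aM.
Qed.

(** Dually, an orbit tending to infinity excludes finite limits. *)
Lemma normal_escapes h V K a :
  normal_on V (range (fun n => iter n h)) -> compact K -> K `<=` V -> K a ->
  (forall M : R, exists N, forall n, (N <= n)%N -> M < nm (iter n h a)) ->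
  forall M : R, exists N, forall n, (N <= n)%N -> forall w, K w ->
    M < nm (iter n h w).
Proof.
move=> nV cK KV Ka aM M; apply: contrapT => unb.
have /choice[m mP] : forall k : nat, exists n, (k <= n)%N /\
    exists2 w, K w & nm (iter n h w) <= M.
  move=> k; apply: contrapT => nk; apply: unb; exists k => n kn w Kw.
  by rewrite ltNge; apply/negP => ?; apply: nk; exists n; split => //; exists w.
have [|s si [[f cvf]|dv]] := nV (fun k => iter (m k) h).
- by move=> n; exists (m n).
- have /uniformC_P/(_ 1 ltr01)[N NP] := cvf K cK KV.
  have [N' N'P] := aM (nm (f a) + 1).
  pose n := maxn N N'.
  have := N'P (m (s n)) _; rewrite ltNge => /(_ _)/negP; apply.
    have sn : (n <= s n)%N.
      elim: (n) => [//|k IH]; exact: leq_ltn_trans IH (si _ _ (ltnSn k)).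
    have [+ _] := mP (s n); apply: leq_trans; apply: leq_trans sn; exact: leq_maxr.
  have := NP n (leq_maxl _ _) a Ka.
  have := ler_modulusB (iter (m (s n)) h a) (f a); rewrite /=; lra.
- have [N _ NP] := dv K cK KV M; have [_ [w Kw]] := mP (s N).
  by have := NP N (leqnn N) w Kw; rewrite modulusE ltcR /= leNgt => ->.
Qed.

End Normality.

(** * Propagation of geometric decay *)
Section Decay.
Variable R : realType.
Local Notation C := (Cplx R).
Local Notation nm := (@modulus R).

Lemma bin_le_expn2 n m : ('C(n, m) <= 2 ^ n)%N.
Proof.
elim: n m => [[|m]//|n IH [|m]]; first by rewrite bin0 expn_gt0.
by rewrite binS expnS mul2n -addnn leq_add.
Qed.

Lemma expn_le_ffact n m : (n.+1 ^ m <= (n + m) ^_ m)%N.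
Proof.
elim: m => [//|m IH]; rewrite addnS ffactSS expnS leq_mul//.
by rewrite ltnS leq_addr.
Qed.

(** n.+1 ^ m is at most the falling factorial of n + m, that is m! times a binomial
    coefficient. *)
Lemma poly_le_exp n m : (n.+1 ^ m <= m`! * 2 ^ m * 2 ^ n)%N.
Proof.
apply: leq_trans (expn_le_ffact n m) _.
rewrite -bin_ffact mulnC -mulnA leq_mul2l; apply/orP; right.
by rewrite -expnD addnC bin_le_expn2.
Qed.

Lemma small_half_exp (c e : R) : 0 < e -> exists N, forall n, (N <= n)%N -> c / 2 ^+ n < e.
Proof.
move=> e0; exists (Num.truncn (`|c| / e)).+1 => n Nn.
rewrite ltr_pdivrMr ?exprn_gt0// -ltr_pdivrMl// mulrC.
apply: (@le_lt_trans _ _ (`|c| / e)); first by rewrite ler_pM2r ?invr_gt0// ler_norm.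
apply: (lt_le_trans (truncnS_gt _)); rewrite -natrX ler_nat.
by apply: leq_trans Nn _; rewrite ltnW// ltn_expl.
Qed.

Lemma poly_over_exp_small (c e : R) (m : nat) : 0 <= c -> 0 < e ->
  exists N, forall n, (N <= n)%N -> c * n.+1%:R ^+ m / 4 ^+ n < e.
Proof.
move=> c0 e0; have [N NP] := small_half_exp (c * (m`! * 2 ^ m)%:R) e0.
exists N => n /NP; apply: le_lt_trans.
rewrite -mulrA -[leRHS]mulrA; apply: ler_wpM2l => //.
have -> : (4 : R) ^+ n = 2 ^+ n * 2 ^+ n by rewrite -exprMn; congr (_ ^+ _); ring.
rewrite invfM mulrA ler_wpM2r ?invr_ge0 ?exprn_ge0// ler_pdivrMr ?exprn_gt0//.
by rewrite -!natrX -natrM ler_nat poly_le_exp.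
Qed.

(** Geometric decay near the centre of a disc together with polynomial growth on
    the whole disc forces convergence to 0 on the half disc. The p-th powers make
    the decay fast enough to beat any given ratio of radii. *)
Lemma decay_half_disc (G : nat -> C -> C) (a : C) (r0 r c : R) (q : nat) :
  (forall n, smooth 2 (G n)) -> 0 < r0 -> r0 <= r -> 0 <= c ->
  (forall n w, cdisc a r w -> nm (G n w) <= c * n.+1%:R ^+ q) ->
  (forall n w, cdisc a r0 w -> nm (G n w) <= c / 2 ^+ n) ->
  forall w, cdisc a (r / 2) w ->
  forall e, 0 < e -> exists n, nm (G n w) < e.
Proof.
move=> sG r00 r0r c0 Gr Gr0 w wr e e0.
have rpos : 0 < r by exact: lt_le_trans r0r.
have [wr0|r0w] := lerP (nm (w - a)) r0.
  have [N NP] := small_half_exp c e0; exists N.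
  exact: le_lt_trans (Gr0 _ _ wr0) (NP _ _).
(* with P = p.+1 powers the decay rate 2 ^ - P beats the ratio r0 / r *)
have [p pP] : exists p : nat, r / r0 <= 2 ^+ p.+1.
  exists (Num.truncn (r / r0)); apply/ltW/(lt_le_trans (truncnS_gt _)).
  by rewrite -natrX ler_nat ltnW// ltn_expl.
pose P := p.+1.
have cc : 0 <= expR 1 * (c ^+ 2) ^+ P by rewrite mulr_ge0 ?expR_ge0 ?exprn_ge0.
have ee : 0 < (e ^+ 2) ^+ P by rewrite !exprn_gt0.
have [N NP] := poly_over_exp_small (q * (2 * P)) cc ee.
have {}NP := NP N (leqnn N).
set M : R := N.+1%:R ^+ (q * (2 * P)) in NP.
have M1 : 1 <= M by rewrite exprn_ege1// ler1n.
have rN : 0 < (r ^+ 2) ^+ N by rewrite !exprn_gt0.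
pose B : R := (c ^+ 2) ^+ P * M / (r ^+ 2) ^+ N.
have B0 : 0 <= B.
  apply: divr_ge0; last exact: ltW.
  by apply: mulr_ge0; rewrite ?exprn_ge0.
exists N; rewrite ltNge; apply/negP => eG.
have sq z : nm (G N z ^+ P) ^+ 2 = (nm (G N z) ^+ 2) ^+ P.
  by rewrite modulusX exprAC.
have le2 m (x y : R) : 0 <= x -> x <= y -> (x ^+ 2) ^+ m <= (y ^+ 2) ^+ m.
  by move=> x0 xy; rewrite !lerXn2r ?nnegrE ?exprn_ge0// (le_trans x0).
have on_r0 z : nm (z - a) = r0 -> nm (G N z ^+ P) ^+ 2 <= B * (r0 ^+ 2) ^+ N.
  move=> zr0; rewrite sq.
  apply: (@le_trans _ _ (((c / 2 ^+ N) ^+ 2) ^+ P)).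
    by apply: le2; [exact: modulus_ge0 | apply: Gr0; rewrite /cdisc /= zr0].
  have rX : (r ^+ 2) ^+ N <= (2 ^+ P ^+ 2) ^+ N * (r0 ^+ 2) ^+ N.
    by rewrite -!exprMn; apply: le2; [exact: ltW | rewrite -ler_pdivrMr].
  rewrite /B mulrAC ler_pdivlMr// expr_div_n expr_div_n -!mulrA.
  apply: ler_wpM2l; first by rewrite !exprn_ge0.
  rewrite mulrC ler_pdivrMr ?exprn_gt0//; apply: (le_trans rX).
  have -> : ((2 : R) ^+ N ^+ 2) ^+ P = (2 ^+ P ^+ 2) ^+ N.
    by rewrite -!exprM mulnCA [in RHS]mulnCA (mulnC N).
  rewrite [leLHS]mulrC; apply: ler_wpM2r; first by rewrite !exprn_ge0.
  by apply: ler_peMl => //; rewrite !exprn_ge0// ltW.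
have on_r z : nm (z - a) = r -> nm (G N z ^+ P) ^+ 2 <= B * (r ^+ 2) ^+ N.
  move=> zr; rewrite sq /B divfK ?gt_eqF//.
  apply: (@le_trans _ _ (((c * N.+1%:R ^+ q) ^+ 2) ^+ P)).
    by apply: le2; [exact: modulus_ge0 | apply: Gr; rewrite /cdisc /= zr].
  rewrite [leLHS](_ : _ = (c ^+ 2) ^+ P * M)//.
  rewrite -[LHS]exprM exprMn -[X in _ = X * _]exprM; congr (_ * _).
  exact: esym (exprM _ _ _).
have wr2 : nm (w - a) <= r / 2 by exact: wr.
have := three_circles (smoothX P (sG N)) r00 r0r on_r0 on_r (w := w).
have wann : r0 <= nm (w - a) <= r by rewrite ltW//=; apply: le_trans wr2 _; lra.
move=> /(_ wann); rewrite leNgt sq => /negP; apply.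
apply: lt_le_trans (le2 _ _ _ (ltW e0) eG); apply: le_lt_trans NP.
have w4 : (nm (w - a) ^+ 2) ^+ N <= (r ^+ 2) ^+ N / 4 ^+ N.
  rewrite -expr_div_n lerXn2r ?nnegrE ?exprn_ge0 ?modulus_ge0//.
    by rewrite divr_ge0// exprn_ge0// ltW.
  apply: (@le_trans _ _ ((r / 2) ^+ 2)).
    by rewrite lerXn2r ?nnegrE ?modulus_ge0// divr_ge0// ltW.
  by rewrite expr_div_n (_ : 2 ^+ 2 = 4 :> R)//; ring.
apply: le_trans (ler_wpM2l _ w4) _; first by rewrite mulr_ge0// expR_ge0.
rewrite [leLHS](_ : _ = expR 1 * (c ^+ 2) ^+ P * M / 4 ^+ N)//.
rewrite /B; move: rN; move: ((r ^+ 2) ^+ N) (4 ^+ N) ((c ^+ 2) ^+ P) => X Y Z X0.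
rewrite [LHS](_ : _ = expR 1 * Z * M / Y * (X / X)); last by ring.
by rewrite divff ?gt_eqF// mulr1.
Qed.
End Decay.

(** * Basins are unions of Fatou components *)
Section Basins.
Variable R : realType.
Local Notation C := (Cplx R).
Local Notation nm := (@modulus R).
Implicit Types (h f : C -> C) (A D F U : set C).

Lemma connected_disc (r : R) : connected (disc (0 : C) r).
Proof.
have [r0|r0] := ltP 0 r; last first.
  have -> : disc (0 : C) r = set0.
    apply/seteqP; split => // w; rewrite /disc /= => h.
    by have := lt_le_trans h r0; rewrite ltNge modulus_ge0.
  exact: connected0.
pose seg (w : C) := (fun t => line 0 w t) @` `[0, 1]%classic.
have -> : disc (0 : C) r = \bigcup_(w in disc (0 : C) r) seg w.
  apply/seteqP; split=> w.
    move=> rw; exists w => //; exists 1; first by rewrite /= in_itv /= ler01 lexx.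
    by rewrite /line add0r (_ : cplx 1 0 = 1)// mul1r.
  move=> [v vr] [t]; rewrite /= in_itv /= => /andP[t0 t1] <-.
  rewrite /disc /= /line subr0 add0r modulusM modulus_real ger0_norm//.
  apply: le_lt_trans (_ : nm v < r); last by move: vr; rewrite /disc /= subr0.
  by rewrite ler_piMl// modulus_ge0.
apply: bigcup_connected.
  exists 0 => w _; exists 0; first by rewrite /= in_itv /= lexx ler01.
  exact: line0.
move=> w _; apply: connected_continuous_connected.
  exact: segment_connected.
by apply: continuous_subspaceT; exact: continuous_line.
Qed.

(** A component is connected, so a subset of F that is open and relatively closed
    cannot split it. *)
Lemma component_sub_clopen F A x : open A -> A x -> A `<=` F ->
  (forall z, F z -> (forall r, 0 < r -> exists2 a, A a & disc z r a) -> A z) ->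
  connected_component F x `<=` A.
Proof.
move=> oA Ax AF cA; pose U := connected_component F x.
have UF : U `<=` F by exact: connected_component_sub.
have Ux : U x by apply: connected_component_refl; exact: AF.
have : connected U by exact: component_connected.
move=> /(_ (U `&` A)) H; have {H}UA : U `&` A = U.
  apply: H; first by exists x.
  - by exists A.
  - exists (closure A); first exact: closed_closure.
    apply/seteqP; split=> z [Uz Az]; split => //; first exact: subset_closure.
    apply: cA => [|r r0]; first exact: UF.
    by have [a [? ?]] := Az _ (nbhs_disc z r0); exists a.
by rewrite -/U -UA => z [].
Qed.

Lemma bounded_of_eventually (u : nat -> R) (N : nat) (M : R) :
  (forall n, (N <= n)%N -> u n <= M) -> exists L, forall n, u n <= L.
Proof.
elim: N M => [|N IH] M H; first by exists M => n; exact: H.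
apply: (IH (Num.max M (u N))) => n; rewrite leq_eqVlt => /orP[/eqP <-|/H nM].
  by rewrite le_max lexx orbT.
by rewrite le_max nM.
Qed.

(** The radii used to pass from a limit point z of a basin to a point a of it:
    z lies well inside a disc around a that stays in the domain of normality. *)
Lemma limit_point_discs V z A : open V -> V z ->
  (forall r, 0 < r -> exists2 a, A a & disc z r a) ->
  exists a (r : R), [/\ A a, 0 < r, cdisc a r `<=` V & cdisc a (r / 4) z].
Proof.
move=> /openP_disc oV Vz Az; have [r r0 rV] := oV _ Vz.
have [a Aa az] := Az (r / 8) (divr_gt0 r0 (ltr0Sn _ _)).
move: az; rewrite /disc /= => az.
exists a, (r / 2); split => //; first by rewrite divr_gt0.
- move=> w wa; apply: rV; rewrite /disc /=.
  have := modulus_dist w a z; move: wa; rewrite /cdisc /=; lra.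
- by rewrite /cdisc /= modulusC; lra.
Qed.

Lemma contraction_iter (k : C -> C) (d : R) :
  (forall z, nm z < d -> nm (k z) <= nm z / 2) ->
  forall n z, nm z < d -> nm (iter n k z) <= nm z / 2 ^+ n.
Proof.
move=> kd; elim=> [|n IH] z zd; first by rewrite expr0 divr1.
have h := IH z zd; rewrite iterS exprSr invfM mulrA.
apply: le_trans (kd _ _) _.
  apply: le_lt_trans h (le_lt_trans _ zd).
  by rewrite ler_piMr ?modulus_ge0// invf_le1 ?exprn_gt0// exprn_ege1// ler1n.
by rewrite ler_wpM2r.
Qed.

Lemma iter_double h n z : iter n (h \o h) z = iter n.*2 h z.
Proof. by elim: n => [//|n IH]; rewrite doubleS /= IH. Qed.

Section Attracting2Cycle.
Variables (h : C -> C) (d : R).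
Hypotheses (hs : smooth 2 h) (d0 : 0 < d) (h2 : h (h 0) = 0).
Hypothesis hd : forall z, nm z < d -> nm (h (h z)) <= nm z / 2.

Let A : set C := [set z | exists n, nm (iter n.*2 h z) < d].

Let ch : continuous h. Proof. exact: smooth_continuous hs. Qed.

Let trap n z : nm z < d -> nm (iter n.*2 h z) <= d / 2 ^+ n.
Proof.
move=> zd; rewrite -iter_double; apply: le_trans (contraction_iter hd n zd) _.
by rewrite ler_wpM2r ?invr_ge0 ?exprn_ge0// ltW.
Qed.

Let preV n : open [set w | nm (iter n.*2 h w) < d].
Proof.
apply/openP_disc => z zd.
have cn : {for z, continuous (fun w => nm (iter n.*2 h w))}.
  by apply: continuous_comp; [exact: continuous_iter | exact: continuous_modulus].
by have /nbhs_discP[r r0 rP] := near_lt cn zd; exists r.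
Qed.

Let oA : open A.
Proof.
apply/openP_disc => z [n zn]; have /openP_disc/(_ z zn)[r r0 rP] := @preV n.
by exists r => // w /rP ?; exists n.
Qed.

Let cycle_limit n0 (b : bool) (e : R) : 0 < e -> exists N, forall n, (N <= n)%N ->
  forall w, nm (iter n0.*2 h w) < d ->
    nm (iter (b + n.*2) h w - (if b then h 0 else 0)) < e.
Proof.
move=> e0.
have even (e' : R) : 0 < e' -> exists N, forall n, (N <= n)%N ->
    forall w, nm (iter n0.*2 h w) < d -> nm (iter n.*2 h w) < e'.
  move=> e'0; have [N NP] := small_half_exp d e'0.
  exists (N + n0)%N => n nN w wd.
  have -> : n.*2 = ((n - n0).*2 + n0.*2)%N.
    by rewrite -doubleD subnK// (leq_trans _ nN)// leq_addl.
  rewrite iterD; apply: le_lt_trans (trap _ wd) _.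
  by apply: NP; rewrite -(leq_add2r n0) subnK// (leq_trans _ nN)// leq_addl.
case: b; last first.
  have [N NP] := even e e0; exists N => n nN w wd; rewrite subr0 add0n; exact: NP.
have [e' e'0 eP] := (continuousC_discP h 0).1 (@ch 0) e e0.
have [N NP] := even e' e'0; exists N => n nN w wd.
by rewrite add1n iterS; apply: eP; rewrite subr0; exact: NP.
Qed.

Let AF : A `<=` Fatou h.
Proof.
move=> z [n0 zn]; exists [set w | nm (iter n0.*2 h w) < d]; split => //.
apply: (normal_attracted_2cycle (phi := fun b : bool => if b then h 0 else 0)).
exact: cycle_limit.
Qed.

(* z is reached from a basin point a: decay near a, whose orbit enters the trap,
   spreads because the iterates are bounded around a *)
Let clA z : Fatou h z -> (forall r, 0 < r -> exists2 a, A a & disc z r a) -> A z.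
Proof.
move=> [V [oV Vz nV]] Az.
have [a [r [[n0 an] r0 rV za]]] := limit_point_discs oV Vz Az.
have [M MP] : exists M, forall n, nm (iter n h a) <= M.
  have [N1 N1P] := cycle_limit n0 false ltr01.
  have [N2 N2P] := cycle_limit n0 true ltr01.
  apply: (@bounded_of_eventually _ (maxn N1.*2 N2.*2).+1 (nm (h 0) + 1)).
  move=> n nN.
  have nE : n = (odd n + (n./2).*2)%N by rewrite odd_double_half.
  have n2 : (maxn N1 N2 <= n./2)%N.
    rewrite geq_max -(doubleK N1) -(doubleK N2) !half_leq//.
      by rewrite (leq_trans _ nN)// ltnW// ltnS leq_maxr.
    by rewrite (leq_trans _ nN)// ltnW// ltnS leq_maxl.
  move: n2; rewrite geq_max => /andP[n21 n22].
  rewrite nE; case: (odd n).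
    have := N2P _ n22 a an => /ltW; rewrite -lerBlDl; apply: le_trans.
    exact: ler_modulusB.
  have := N1P _ n21 a an; rewrite subr0 => /ltW/le_trans; apply.
  by rewrite lerDr modulus_ge0.
have ca : cdisc a r a by rewrite /cdisc /= subrr modulus0 ltW.
have [L LP] := normal_bounded ch nV (@compact_cdisc _ a r) rV ca MP.
have [r1 r10 r1P] : exists2 r1, 0 < r1 & disc a r1 `<=` [set w | nm (iter n0.*2 h w) < d].
  by have /openP_disc/(_ a an) := @preV n0.
pose r2 := Num.min (r1 / 2) r.
pose G n z := iter (n + n0).*2 h z.
pose c := Num.max d L.
have dc : d <= c by rewrite le_max lexx.
have [|||||||n] := @decay_half_disc _ G a r2 r c 0 _ _ _ _ _ _ z _ d d0.
- by move=> n; exact: smooth_iter.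
- by rewrite lt_min r0 divr_gt0.
- by rewrite ge_min lexx orbT.
- exact: le_trans (ltW d0) dc.
- move=> n w wr; rewrite expr0 mulr1; apply: le_trans (LP _ _ wr) _.
  by rewrite le_max lexx orbT.
- move=> n w wr; rewrite /G doubleD iterD.
  have : nm (iter n0.*2 h w) < d.
    apply: r1P; apply: le_lt_trans wr _; rewrite gt_min; apply/orP; left.
    by rewrite ltr_pdivrMr//; lra.
  move=> /(trap n)/le_trans; apply; by rewrite ler_wpM2r// invr_ge0 exprn_ge0.
- by apply: le_trans za _; lra.
- by move=> nz; exists (n + n0)%N.
Qed.

(** The set A is the basin of 0 under two steps of h. Two steps map the component
    of 0 to a connected subset of A that contains 0, hence into that component. *)
Lemma attracting_2cycle_periodic D : D `<=` disc 0 d -> lies_in_periodic h D.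
Proof.
move=> Dd; pose U := connected_component (Fatou h) 0.
have dA : disc 0 d `<=` A by move=> w; rewrite /disc /= subr0 => wd; exists 0%N.
have A0 : A 0 by apply: dA; exact: disc_center.
have UA : U `<=` A by exact: component_sub_clopen.
have U0 : U 0 by apply: connected_component_refl; exact: AF.
exists U; last first.
  move=> w /Dd dw; apply: (connected_component_max _ _ (@connected_disc d)) dw.
    exact: disc_center.
  exact: subset_trans dA AF.
have FU : Fatou_component h U by exists 0 => //; exact: AF.
split=> //; exists 2%N => //; split => //.
apply: connected_component_max.
- by exists 0.
- move=> _ [w /UA [n wn] <-]; apply: AF; exists n.
  rewrite -iterD addnC iterD /= -[nm _]/(nm (h (h _))).
  apply: le_lt_trans (hd wn) _; rewrite ltr_pdivrMr//.
  by have := modulus_ge0 (iter n.*2 h w); move: wn; lra.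
- apply: connected_continuous_connected; first exact: component_connected.
  by apply: continuous_subspaceT; exact: continuous_iter.
Qed.

End Attracting2Cycle.
End Basins.

Section TranslatedBasin.
Variable R : realType.
Local Notation C := (Cplx R).
Local Notation nm := (@modulus R).
Variables (h : C -> C) (tau : C) (d : R).
Hypotheses (hs : smooth 3 h) (htau : forall z, h (z + tau) = h z + tau).
Hypotheses (d0 : 0 < d) (dtau : 2 * d <= nm tau).
Hypothesis hd : forall z, nm z < d -> nm (h z - tau) <= nm z / 2.

(* k fixes 0, and its iterates are those of h corrected by multiples of tau *)
Let k z := h z - tau.

Let A (j : nat) : set C := [set z | exists n, nm (iter n k z - tau *+ j) < d].

Let ks : smooth 3 k. Proof. exact: smoothD hs (smooth_cst 3 (- tau)). Qed.
Let ck : continuous k. Proof. exact: smooth_continuous ks. Qed.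

Lemma modulusMn (z : C) n : nm (z *+ n) = n%:R * nm z.
Proof. by rewrite mulr_natl; exact: normcMn. Qed.

Let htauj z j : h (z + tau *+ j) = h z + tau *+ j.
Proof. by elim: j => [|j IH]; rewrite ?addr0// mulrSr !addrA htau IH. Qed.

Let ktauj n z j : iter n k (z + tau *+ j) = iter n k z + tau *+ j.
Proof. by elim: n => [//|n IH]; rewrite !iterS IH /k htauj addrAC. Qed.

Let iter_hk n z : iter n h z = iter n k z + tau *+ n.
Proof.
elim: n => [|n IH]; first by rewrite addr0.
by rewrite !iterS IH htauj /k mulrS addrA subrK.
Qed.

Let T0 : 0 < nm tau.
Proof. by apply: lt_le_trans dtau; rewrite mulr_gt0. Qed.

Let trap j m n z : nm (iter n k z - tau *+ j) < d ->
  nm (iter (m + n) k z - tau *+ j) <= d / 2 ^+ m.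
Proof.
move=> zd; rewrite iterD -[iter n k z](subrK (tau *+ j)) ktauj addrK.
apply: le_trans (contraction_iter hd m zd) _.
by rewrite ler_wpM2r ?invr_ge0 ?exprn_ge0// ltW.
Qed.

Let trap_le j m n z : nm (iter n k z - tau *+ j) < d -> (n <= m)%N ->
  nm (iter m k z - tau *+ j) < d.
Proof.
move=> zd n_m; rewrite -(subnK n_m) iterD.
rewrite -[iter n k z](subrK (tau *+ j)) ktauj addrK.
apply: le_lt_trans (contraction_iter hd _ zd) (le_lt_trans _ zd).
by rewrite ler_piMr ?modulus_ge0// invf_le1 ?exprn_gt0// exprn_ege1// ler1n.
Qed.

Let preV n j : open [set w | nm (iter n k w - tau *+ j) < d].
Proof.
apply/openP_disc => z zd.
have cn : {for z, continuous (fun w => nm (iter n k w - tau *+ j))}.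
  exact: (continuous_comp (@continuous_iter _ k n ck z)
    (@continuous_dist _ (tau *+ j) _)).
by have /nbhs_discP[r r0 rP] := near_lt cn zd; exists r.
Qed.

Let oA j : open (A j).
Proof.
apply/openP_disc => z [n zn]; have /openP_disc/(_ z zn)[r r0 rP] := @preV n j.
by exists r => // w /rP ?; exists n.
Qed.

Let escape (M c : R) : exists N, forall n, (N <= n)%N ->
  forall w, nm (iter n k w) <= c -> M < nm (iter n h w).
Proof.
exists (Num.truncn ((M + c) / nm tau)).+1 => n nN w wc.
have : M + c < n%:R * nm tau.
  rewrite -ltr_pdivrMr//; apply: lt_le_trans (truncnS_gt _) _.
  by rewrite ler_nat.
rewrite -modulusMn iter_hk.
have := modulusB (iter n k w + tau *+ n) (iter n k w).
rewrite [X in nm (X - _)]addrC addrK; lra.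
Qed.

Let bounded_near n j z : nm (iter n k z - tau *+ j) < d ->
  nm (iter n k z) <= d + nm (tau *+ j).
Proof. have := ler_modulusB (iter n k z) (tau *+ j); lra. Qed.

Let AF j : A j `<=` Fatou h.
Proof.
move=> z [n0 zn]; exists [set w | nm (iter n0 k w - tau *+ j) < d]; split => //.
apply: normal_escaping => M.
have [N NP] := escape M (d + nm (tau *+ j)).
exists (maxn N n0) => n; rewrite geq_max => /andP[Nn n0n] w wd.
by apply: NP => //; apply: bounded_near; exact: trap_le wd n0n.
Qed.

(* as for cycles, except that the bound around a is polynomial in the exponent and
   comes from Harnack's inequality *)
Let clA j z : Fatou h z ->
  (forall r, 0 < r -> exists2 a, A j a & disc z r a) -> A j z.
Proof.
move=> [V [oV Vz nV]] Az.
have [a [r [[n0 an] r0 rV za]]] := limit_point_discs oV Vz Az.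
have ca : cdisc a r a by rewrite /cdisc /= subrr modulus0 ltW.
have [L LP] : exists L, forall n, nm (iter n k a) <= L.
  apply: (@bounded_of_eventually _ _ n0 (d + nm (tau *+ j))) => n n0n.
  by apply: bounded_near; exact: trap_le an n0n.
have L0 : 0 <= L := le_trans (modulus_ge0 _) (LP 0%N).
have [|N NP] := normal_escapes nV (@compact_cdisc _ a r) rV ca _ 1.
  by move=> M; have [N NP] := escape M L; exists N => n Nn; exact: NP.
have [q hq] : exists q : nat, expR 2 <= q%:R :> R.
  by exists (Num.truncn (expR 2 : R)).+1; rewrite ltW// truncnS_gt.
have q0 : (0 < q)%N by rewrite -(ltr_nat R) (lt_le_trans (expR_gt0 _) hq).
pose n1 := maxn N n0; pose T := nm tau.
have growth n w : (N <= n)%N -> cdisc a (r / 2) w ->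
    nm (iter n h w) <= (L + n%:R * T) ^+ q.
  move=> Nn wr; apply: le_trans (_ : nm (iter n h a) ^+ q <= _).
    by apply: (harnack_power (smooth_iter n hs) r0 hq _ wr) => v; exact: NP.
  rewrite lerXn2r ?nnegrE ?modulus_ge0//.
    by rewrite addr_ge0// mulr_ge0// ltW.
  by rewrite iter_hk (le_trans (modulusD _ _))// modulusMn lerD2r.
pose X := L + n1%:R * T + T.
have X0 : 0 <= X by rewrite !addr_ge0 ?mulr_ge0 ?modulus_ge0.
have XP m : L + (m + n1)%:R * T <= X * m.+1%:R.
  have m0 : 0 <= (m%:R : R) by [].
  have t0 : 0 <= m%:R * (L + n1%:R * T).
    by rewrite mulr_ge0// addr_ge0// mulr_ge0// ltW.
  rewrite /X natrD -natr1; have := ltW T0; rewrite -/T; lra.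
clearbody X.
have [r1 r10 r1P] : exists2 r1, 0 < r1 &
    disc a r1 `<=` [set w | nm (iter n0 k w - tau *+ j) < d].
  by have /openP_disc/(_ a an) := @preV n0 j.
pose r2 := Num.min (r1 / 2) (r / 2).
pose c := X ^+ q + X + nm (tau *+ j) + d.
pose G m z := iter (m + n1) k z - tau *+ j.
have r20 : 0 < r / 2 by rewrite divr_gt0.
have dc : d <= c.
  have := exprn_ge0 q X0; have := modulus_ge0 (tau *+ j).
  rewrite /c; lra.
have [|||||||m] := @decay_half_disc _ G a r2 (r / 2) c q _ _ _ _ _ _ z _ d d0.
- move=> m; apply: smoothD (smooth_cst _ _).
  by apply: smooth_iter; exact: smoothS.
- by rewrite lt_min r20 divr_gt0.
- by rewrite ge_min lexx orbT.
- exact: le_trans (ltW d0) dc.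
- move=> m w wr; rewrite /G.
  have := growth (m + n1)%N w (leq_trans (leq_maxl _ _) (leq_addl _ _)) wr.
  rewrite iter_hk => gw.
  have kw : nm (iter (m + n1) k w) <=
      (L + (m + n1)%:R * T) ^+ q + (m + n1)%:R * T.
    have := modulusB (iter (m + n1) k w + tau *+ (m + n1)) (tau *+ (m + n1)).
    by rewrite addrK modulusMn -/T; move: gw; lra.
  have m1 : 1 <= (m.+1%:R : R) by rewrite ler1n.
  have mq : m.+1%:R <= (m.+1%:R : R) ^+ q by rewrite ler_eXnr.
  have h1 : (L + (m + n1)%:R * T) ^+ q <= X ^+ q * m.+1%:R ^+ q.
    rewrite -exprMn lerXn2r ?nnegrE ?XP//.
      by rewrite addr_ge0// mulr_ge0// ltW.
    by rewrite mulr_ge0.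
  have h2 : (m + n1)%:R * T <= X * m.+1%:R ^+ q.
    have := ler_wpM2l X0 mq; have := XP m; lra.
  have h3 : nm (tau *+ j) <= nm (tau *+ j) * m.+1%:R ^+ q.
    by rewrite ler_peMr ?modulus_ge0// (le_trans m1).
  have h4 : 0 <= d * m.+1%:R ^+ q by rewrite mulr_ge0 ?exprn_ge0// ltW.
  apply: le_trans (modulusB _ _) _; rewrite /c; lra.
- move=> m w wr; rewrite /G.
  have wd : nm (iter n0 k w - tau *+ j) < d.
    apply: r1P; apply: le_lt_trans wr _; rewrite gt_min; apply/orP; left.
    by rewrite ltr_pdivrMr//; lra.
  have -> : (m + n1 = m + (n1 - n0) + n0)%N by rewrite -addnA subnK// leq_maxr.
  rewrite -addnA; apply: le_trans (trap m (trap_le wd (leq_addl _ _))) _.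
  by rewrite ler_wpM2r// invr_ge0 exprn_ge0.
- by apply: le_trans za _; lra.
- by move=> mz; exists (m + n1)%N.
Qed.

(** The component of j tau lies in the basin A j of points whose corrected orbit
    converges to j tau; distinct translates are disjoint as 2 d <= |tau|. *)
Lemma translated_basin_wandering D : D `<=` disc 0 d -> lies_in_wandering h D.
Proof.
move=> Dd; pose U j := connected_component (Fatou h) (tau *+ j).
have dA j w : nm (w - tau *+ j) < d -> A j w by move=> wd; exists 0%N.
have Atau j : A j (tau *+ j) by apply: dA; rewrite subrr modulus0.
have UA j : U j `<=` A j.
  exact: component_sub_clopen (@oA j) (Atau j) (@AF j) (@clA j).
have FU j : Fatou_component h (U j) by exists (tau *+ j) => //; exact: (AF (Atau j)).
have Utau j : U j (tau *+ j) by apply: connected_component_refl; exact: (AF (Atau j)).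
have k0 : k 0 = 0.
  apply/eqP; rewrite -modulus_eq0 eq_le modulus_ge0 andbT.
  by have := hd (z := 0); rewrite modulus0 mul0r; apply.
have itk0 n : iter n k 0 = 0 by elim: n => [//|n IH]; rewrite iterS IH.
have U0 : U 0%N 0 by exact: (Utau 0%N).
exists (U 0%N); last first.
  move=> w /Dd dw; apply: (connected_component_max _ _ (@connected_disc R d)) dw.
    exact: disc_center.
  by move=> v vd; apply: (AF (j := 0%N)); exact: dA.
split=> //; exists U.
- move=> j; split=> //; apply: connected_component_max.
  + by exists 0 => //; rewrite iter_hk itk0 add0r.
  + move=> _ [w /UA [n wn] <-]; apply: (AF (j := j)); exists n.
    rewrite iter_hk ktauj addrK -iterD.
    move: wn; rewrite mulr0n subr0 => wn.
    have := @trap_le 0%N (n + j)%N n w; rewrite mulr0n !subr0; apply => //.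
    exact: leq_addr.
  + apply: connected_continuous_connected; first exact: component_connected.
    by apply: continuous_subspaceT; apply: continuous_iter; exact: smooth_continuous hs.
- move=> i j ij; apply/seteqP; split=> // z [/UA[n zn] /UA[m zm]].
  have zi := trap_le zn (leq_addr m n); have zj := trap_le zm (leq_addl n m).
  have : nm (tau *+ i - tau *+ j) < nm tau.
    apply: le_lt_trans (modulus_dist _ (iter (n + m) k z) _) _.
    by rewrite modulusC; move: zi zj dtau; lra.
  move: ij => {zn zm zi zj} /eqP; wlog ij : i j / (i < j)%N.
    move=> H; rewrite neq_lt => /orP[|] ij; first by apply: H; rewrite // ltn_eqF.
    by rewrite modulusC; apply: H; rewrite // ltn_eqF.
  move=> _.
  rewrite modulusC -mulrnBr ?(ltnW ij)// modulusMn ltNge.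
  by rewrite ler_peMl ?modulus_ge0// ler1n subn_gt0.
Qed.

End TranslatedBasin.

(** * The exponential function and the two maps *)
Section Maps.
Variable R : realType.
Local Notation C := (Cplx R).
Local Notation nm := (@modulus R).
Implicit Types (f g h F : C -> C).

Definition cexp (z : C) : C :=
  cplx (expR (re z) * cos (im z)) (expR (re z) * sin (im z)).

Lemma cexpD z w : cexp (z + w) = cexp z * cexp w.
Proof.
apply: complex_ext; rewrite ?reM ?imM /= reD imD expRD ?cosD ?sinD; ring.
Qed.

Lemma cexp0 : cexp 0 = 1.
Proof. by apply: complex_ext; rewrite /= expR0 ?cos0 ?sin0 ?mulr1 ?mulr0. Qed.

Lemma is_derive_cexp0 : is_derive (0 : C) 1 cexp 1.
Proof.
apply/is_derive_complexP => e e0.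
(* the errors below add up to 9 eta |h| *)
pose eta := Num.min 1 (e / 9).
have eta0 : 0 < eta by rewrite lt_min ltr01 divr_gt0.
have eta1 : eta <= 1 by rewrite ge_min lexx.
have eta9 : eta * 9 <= e by rewrite -ler_pdivlMr// ge_min lexx orbT.
clearbody eta.
have [d1 d10 H1] := (is_derive_epsP _ _ _).1 (is_derive_expR (0 : R)) eta eta0.
have [d2 d20 H2] := (is_derive_epsP _ _ _).1 (is_derive_cos (0 : R)) eta eta0.
have [d3 d30 H3] := (is_derive_epsP _ _ _).1 (is_derive_sin (0 : R)) eta eta0.
exists (Num.min (Num.min d1 eta) (Num.min d2 d3)); first by rewrite !lt_min d10 eta0 d20 d30.
move=> h; rewrite !lt_min => /andP[/andP[h1 h2] /andP[h3 h4]].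
rewrite add0r cexp0 mulr1.
have xh := re_le_modulus h; have yh := im_le_modulus h.
apply: le_trans (modulus_le_re_im _) _; rewrite !reB !imB /=.
have := H3 _ (le_lt_trans yh h4); have := H2 _ (le_lt_trans yh h3).
have := H1 _ (le_lt_trans xh h1).
rewrite !addr0 expR0 cos0 sin0 !(oppr0, mulr0, mulr1, addr0).
have x1 : `|re h| <= eta by exact: le_trans xh (ltW h2).
have n0 := modulus_ge0 h; have y0 := normr_ge0 (im h); have x0 := normr_ge0 (re h).
move: (re h) (im h) (expR (re h)) (cos (im h)) (sin (im h)) (nm h) xh yh x1 n0 x0 y0.
move=> x y E c s n xh yh x1 n0 x0 y0 HE Hc Hs {h1 h2 h3 h4}.
have E1 : `|E - 1| <= 2 * `|x|.
  have : `|E - 1| <= `|E - 1 - x| + `|x| by rewrite -{1}[E - 1](subrK x) ler_normD.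
  have : eta * `|x| <= `|x| by rewrite ler_piMl.
  lra.
have E3 : `|E| <= 3.
  have : `|E| <= `|E - 1| + 1 by rewrite -{1}[E](subrK 1) (le_trans (ler_normD _ _))// normr1.
  lra.
have hre : `|E * c - 1 - x| <= eta * n + 3 * (eta * n).
  rewrite (_ : E * c - 1 - x = (E - 1 - x) + E * (c - 1)); last by ring.
  apply: le_trans (ler_normD _ _) _; apply: lerD.
    by apply: le_trans HE _; rewrite ler_pM2l.
  by rewrite normrM ler_pM// (le_trans Hc)// ler_pM2l.
have him : `|E * s - y| <= 3 * (eta * n) + 2 * (eta * n).
  rewrite (_ : E * s - y = E * (s - y) + (E - 1) * y); last by ring.
  apply: le_trans (ler_normD _ _) _; apply: lerD; rewrite normrM.
    by rewrite ler_pM// (le_trans Hs)// ler_pM2l.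
  rewrite [leRHS]mulrA; apply: ler_pM => //; apply: le_trans E1 _.
  by rewrite ler_pM2l.
have : eta * 9 * n <= e * n by rewrite ler_wpM2r.
lra.
Qed.

Lemma is_derive_cexp (z : C) : is_derive z 1 cexp (cexp z).
Proof.
apply/is_derive_complexP => e e0.
have n0 : 0 < nm (cexp z) + 1 by rewrite ltr_wpDl// modulus_ge0.
have [d d0 H] := (is_derive_complexP _ _ _).1 is_derive_cexp0 _ (divr_gt0 e0 n0).
exists d => // h /H; rewrite add0r cexp0 mulr1 => {}H.
rewrite cexpD (_ : _ - _ = cexp z * (cexp h - 1 - h)); last by ring.
rewrite modulusM; apply: le_trans (ler_wpM2l (modulus_ge0 _) H) _.
rewrite mulrA ler_wpM2r ?modulus_ge0// mulrCA.
by apply: ler_piMr; [exact: ltW | rewrite ler_pdivrMr// mul1r lerDl].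
Qed.

Lemma smooth_cexp k : smooth k cexp.
Proof. by elim: k => [//|k IH]; exists cexp => //; exact: is_derive_cexp. Qed.

Definition node0 : C := cplx 0 pi.
Definition node1 : C := cplx 0 (pi / 2).
Definition period : C := cplx 0 (pi *+ 2).

Lemma cexp_period : cexp period = 1.
Proof.
apply: complex_ext; rewrite /= expR0 mul1r mulr2n.
  by rewrite (cosD pi) cospi sinpi mulr0 subr0 mulrNN mulr1.
by rewrite (sinD pi) sinpi mul0r mulr0 addr0.
Qed.

Lemma cexp_node0 : cexp node0 = -1.
Proof. by apply: complex_ext; rewrite /= expR0 mul1r ?cospi ?sinpi ?oppr0. Qed.

Lemma cexp_node1 : cexp node1 = ii R.
Proof. by apply: complex_ext; rewrite /= expR0 mul1r ?cos_pihalf ?sin_pihalf. Qed.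

(** Hermite interpolation in the variable exp z, which takes the distinct values
    1, -1 and i at 0, node0 and node1. The linear term 1 - exp z cancels the
    derivative of z at 0, and the factor (exp z - 1)^2 leaves two coefficients to
    be adjusted at the other nodes. *)
Lemma entire_interpolation (u v0 v1 : C) : exists F, [/\ forall k, smooth k F,
  forall z, F (z + period) = F z + period,
  F 0 = u /\ is_derive (0 : C) 1 F 0, F node0 = v0 & F node1 = v1].
Proof.
have i1 : ii R - 1 != 0.
  by apply/eqP => /(congr1 (@re R)); rewrite reB /= sub0r => /eqP; rewrite oppr_eq0 oner_eq0.
have i1' : ii R + 1 != 0.
  by apply/eqP => /(congr1 (@re R)); rewrite reD /= add0r => /eqP; rewrite oner_eq0.
pose c0 := (v0 - node0 - u - 2) / 4.
pose c1 := ((v1 - node1 - u + (ii R - 1)) / (ii R - 1) ^+ 2 - c0) / (ii R + 1).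
pose Q z := c0 + c1 * (cexp z + 1).
pose P z := z + (u - (cexp z - 1) + (cexp z - 1) * ((cexp z - 1) * Q z)).
have sE k c : smooth k (fun z => cexp z + c).
  by apply: smoothD (smooth_cexp k) (smooth_cst k c).
have sQ k : smooth k Q.
  by apply: smoothD (smooth_cst k c0) (smoothM (smooth_cst k c1) (sE k 1)).
exists P; split.
- move=> k; exact: (smoothD (@smooth_id R k) (smoothD
    (smoothD (smooth_cst k u) (smoothN (sE k (-1))))
    (smoothM (sE k (-1)) (smoothM (sE k (-1)) (sQ k))))).
- by move=> z; rewrite /P /Q cexpD cexp_period mulr1; ring.
- split; first by rewrite /P cexp0; ring.
  have dE : is_derive (0 : C) 1 (fun z => cexp z - 1) 1.
    apply: (is_derive_eq (is_deriveB (is_derive_cexp 0) (is_derive_cst (1 : C) _ _))).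
    by rewrite cexp0 subr0.
  have [Q' /(_ 0) dQ _] := sQ 1%N.
  have := is_deriveD (is_derive_id (0 : C) 1) (is_deriveD
    (is_deriveB (is_derive_cst u _ _) dE) (is_deriveM dE (is_deriveM dE dQ))).
  move=> /is_derive_eq; apply.
  rewrite (_ : ((fun z => cexp z - 1) * Q) 0 = (cexp 0 - 1) * Q 0)//.
  by rewrite cexp0 subrr /GRing.scale /=; ring.
- by rewrite /P /Q cexp_node0 /c0; field.
- by rewrite /P /Q cexp_node1 /c1; field; rewrite i1 i1'.
Qed.

(** A polynomial with this equivariance would agree with z + F 0 at all multiples
    of the period, hence everywhere. *)
Lemma periodic_shift_transcendental F : (forall k, smooth k F) ->
  (forall z, F (z + period) = F z + period) -> F node0 <> node0 + F 0 ->
  transcendental_entire F.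
Proof.
move=> sF Fp Fn; split; first exact: smooth_entire (sF 1%N).
move=> [p pF]; apply: Fn; pose q := p - 'X - (F 0)%:P.
have p0 : period != 0.
  by apply/eqP => /(congr1 (@im R)) /= /eqP; rewrite mulrn_eq0 /= gt_eqF// pi_gt0.
have root_q n : root q (period *+ n).
  rewrite /root !hornerE -pF subr_eq0 subr_eq; apply/eqP.
  elim: n => [|n IH]; first by rewrite mulr0n addr0.
  by rewrite mulrSr Fp IH addrA.
have q0 : q = 0.
  apply: (@roots_geq_poly_eq0 _ _ [seq period *+ i | i <- iota 0 (size q)]).
  - by apply/allP => _ /mapP[i _ ->].
  - by rewrite map_inj_uniq ?iota_uniq//; exact: mulrIn.
  - by rewrite size_map size_iota.
have := congr1 (horner^~ node0) q0; rewrite /q !hornerE -pF => /eqP.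
by rewrite subr_eq0 subr_eq => /eqP ->; rewrite addrC.
Qed.

Lemma superattracting_contraction f g (c : C) : is_derive (0 : C) 1 f 0 ->
  smooth 1 g -> g (f 0) = c ->
  exists2 d, 0 < d & forall z, nm z < d -> nm (g (f z) - c) <= nm z / 2.
Proof.
move=> f0 [g' gg' _] gc.
have /is_derive_complexP/(_ _ (_ : 0 < 1 / 2)) := is_derive_chain f0 (gg' (f 0)).
move=> [|d d0 dP]; first by rewrite divr_gt0.
exists d => // z /dP; rewrite add0r /= gc mulr0 mulr0 subr0 mulrC.
by rewrite mul1r.
Qed.

End Maps.
Arguments period {R}.

(** * The theorem *)
Lemma disc_sub_le (R : realType) (r s : R) :
  0 <= s -> disc (0 : Cplx R) r `<=` disc 0 s -> r <= s.
Proof.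
move=> s0 rs; rewrite leNgt; apply/negP => sr.
have E q : disc (0 : Cplx R) q (cplx s 0) = (s < q).
  by rewrite /disc /mkset subr0 modulus_real ger0_norm.
by have := rs (cplx s 0); rewrite !E ltxx => /(_ sr).
Qed.

Theorem theorem2p4 (R : realType) :
  exists f g : Cplx R -> Cplx R,
    [/\ transcendental_entire f, transcendental_entire g &
      exists Ds : set (set (Cplx R)),
        infinite_set Ds /\
        forall D, Ds D ->
          [/\ domain D,
              lies_in_periodic f D,
              lies_in_periodic g D,
              lies_in_periodic (g \o f) D &
              lies_in_wandering (f \o g) D]].
Proof.
pose a := node0 R; pose b := node1 R; pose t := @period R.
have pi0 : 0 < pi :> R := pi_gt0 R.
have [f [sf ft [f0 df] fa fb]] := entire_interpolation b t 0.
have [g [sg gt [g0 dg] ga gb]] := entire_interpolation a 0 0.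
have [d1 d10 H1] := superattracting_contraction df (sf 1%N) (etrans (congr1 f f0) fb).
have [d2 d20 H2] := superattracting_contraction dg (sg 1%N) (etrans (congr1 g g0) ga).
have [d3 d30 H3] := superattracting_contraction df (sg 1%N) (etrans (congr1 g f0) gb).
have [d4 d40 H4] := superattracting_contraction dg (sf 1%N) (etrans (congr1 f g0) fa).
have t0 : 0 < modulus t.
  by rewrite modulus_gt0; apply/eqP => /(congr1 (@im R)) /= /eqP; rewrite mulrn_eq0 /= gt_eqF.
pose d := Num.min (Num.min d1 d2) (Num.min d3 (Num.min d4 (modulus t / 2))).
have d0 : 0 < d by rewrite !lt_min d10 d20 d30 d40 divr_gt0.
have [dd1 dd2 dd3 dd4 dt] : [/\ d <= d1, d <= d2, d <= d3, d <= d4 & d <= modulus t / 2].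
  by rewrite /d !ge_min !lexx !orbT.
exists f, g; split.
- apply: periodic_shift_transcendental => //.
  rewrite fa f0 => /(congr1 (@im R)); rewrite imD /= mulr2n; lra.
- apply: periodic_shift_transcendental => //.
  rewrite ga g0 => /(congr1 (@im R)); rewrite imD /=; lra.
exists (range (fun n : nat => disc (0 : Cplx R) (d / n.+1%:R))); split.
  pose B n : set (Cplx R) := disc 0 (d / n.+1%:R).
  have injB : injective B.
    move=> m n Bmn; apply: succn_inj; apply: (@mulrIn R 1 (oner_neq0 _)).
    have r0 k : 0 < d / k.+1%:R by rewrite divr_gt0.
    have : d / m.+1%:R = d / n.+1%:R.
      by apply/le_anti/andP; split; apply: disc_sub_le; rewrite ?(ltW (r0 _))//;
        move: Bmn; rewrite /B => ->.
    by move=> /(mulfI (lt0r_neq0 d0)) /invr_inj.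
  move=> /(@finite_preimage _ _ _ B _); rewrite preimage_range.
  by move=> /(_ (in2W injB)); exact: infinite_nat.
move=> _ [n _ <-].
have n0 : 0 < d / n.+1%:R by rewrite divr_gt0.
have sub : disc (0 : Cplx R) (d / n.+1%:R) `<=` disc 0 d.
  move=> w; rewrite /disc /= => /lt_le_trans; apply.
  by rewrite ler_pdivrMr// ler_peMr ?(ltW d0)// ler1n.
split.
- split; [by exists 0; exact: disc_center | exact: open_disc | exact: connected_disc].
- apply: (attracting_2cycle_periodic (sf 2%N) d0 _ _ sub); first by rewrite f0 fb.
  by move=> z zd; rewrite -[f (f z)]subr0 H1// (lt_le_trans zd).
- apply: (attracting_2cycle_periodic (sg 2%N) d0 _ _ sub); first by rewrite g0 ga.
  by move=> z zd; rewrite -[g (g z)]subr0 H2// (lt_le_trans zd).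
- have H z : modulus z < d -> modulus (g (f z)) <= modulus z / 2.
    by move=> zd; rewrite -[g (f z)]subr0 H3// (lt_le_trans zd).
  apply: (attracting_2cycle_periodic (smooth_comp (sg 2%N) (sf 2%N)) d0 _ _ sub).
    by rewrite /= f0 gb f0 gb.
  move=> z zd; have z2 := modulus_ge0 z; have h := H z zd.
  have h' : modulus (g (f (g (f z)))) <= modulus (g (f z)) / 2.
    by apply: H; apply: le_lt_trans h _; lra.
  by apply: le_trans h' _; lra.
- apply: (translated_basin_wandering (tau := t) (smooth_comp (sf 3%N) (sg 3%N)) _ d0 _ _ sub).
  + by move=> z; rewrite /= gt ft.
  + by move: dt; lra.
  + by move=> z zd; rewrite H4// (lt_le_trans zd).
Qed.
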